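(* Consider the two-point boundary value problem, with perturbations $l_\mu\in L^2(t_0,T;\mathbb{R}^n)$ and $l_\nu\in L^2(t_0,T;\mathbb{R}^{n,*})$, $$\frac{d\hat\mu}{dt}=F(t)\hat\mu(t)-G(t)Q(t)G^*(t)\hat\nu(t)+l_\mu(t),$$ $$-\frac{d\hat\nu}{dt}=F^*(t)\hat\nu(t)+H^*(t)R^{-1}(t)H(t)\hat\mu(t)-l_\nu(t),$$ $$\hat\mu(t_0)=-\Pi_0\hat\nu(t_0),\qquad \hat\nu(T)=\Sigma_T\hat\mu(T).$$ The kernels $K(\cdot,\cdot|T)$ and $\Lambda(\cdot,\cdot|T)$ (matrix-valued functions on $[t_0,T]^2$, identified for each fixed $s$ up to null sets in $t$) satisfying, for all $s\in[t_0,T]$, $$\hat\mu(s)=\int_{t_0}^T K(s,t|T)\,l_\nu(t)\,dt\quad\text{for all } l_\nu\in L^2(t_0,T;\mathbb{R}^{n,*})\text{ when } l_\mu\equiv 0,$$ $$\hat\nu(s)=\int_{t_0}^T \Lambda(s,t|T)\,l_\mu(t)\,dt\quad\text{for all } l_\mu\in L^2(t_0,T;\mathbb{R}^{n})\text{ when } l_\nu\equiv 0,$$ are given by $$K(s,t|T)=\Phi_{F,\Sigma}(s,t_0)\Pi_0^{1/2}\bigl(\mathrm{Id}+\Pi_0^{1/2}\Sigma(t_0)\Pi_0^{1/2}\bigr)^{-1}\Pi_0^{1/2}\Phi_{F,\Sigma}^*(t,t_0)+\int_{t_0}^{\min(s,t)}\Phi_{F,\Sigma}(s,\tau)G(\tau)Q(\tau)G^*(\tau)\Phi_{F,\Sigma}^*(t,\tau)\,d\tau,$$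 $$\Lambda(s,t|T)=\Phi_{F,\Pi}^*(T,s)\Sigma_T^{1/2}\bigl(\mathrm{Id}+\Sigma_T^{1/2}\Pi(T)\Sigma_T^{1/2}\bigr)^{-1}\Sigma_T^{1/2}\Phi_{F,\Pi}(T,t)+\int_{\max(s,t)}^{T}\Phi_{F,\Pi}^*(\tau,s)H^*(\tau)R^{-1}(\tau)H(\tau)\Phi_{F,\Pi}(\tau,t)\,d\tau.$$
   Context: Fix $t_0<T$ and positive integers $n,m,d$. $\mathbb{R}^{n,*}$ is the dual of $\mathbb{R}^n$ (identified with $\mathbb{R}^n$), $*$ denotes transposition, $\langle\cdot,\cdot\rangle$ the duality pairing/Euclidean product, $\mathrm{Id}$ the identity. Coefficients: $F\in L^1([t_0,T];\mathbb{R}^{n\times n})$, $G\in L^2([t_0,T];\mathbb{R}^{n\times d})$, $H\in L^2([t_0,T];\mathbb{R}^{m\times n})$, $Q\in L^1([t_0,T];\mathbb{R}^{d\times d})$ symmetric positive semidefinite, $R\in L^2([t_0,T];\mathbb{R}^{m\times m})$ symmetric with $R(t)\succcurlyeq r\,\mathrm{Id}$ a.e. for some $r>0$, and $GQG^*\in L^1$. The matrices $\Pi_0,\Sigma_T\in\mathbb{R}^{n\times n}$ are symmetric positive semidefinite (not assumed invertible); $\Pi_0^{1/2},\Sigma_T^{1/2}$ are their positive semidefinite square roots. All differential equations hold a.e., with absolutely continuous solutions. $\Sigma(\cdot)$ and $\Pi(\cdot)$ are the symmetric positive semidefinite solutions on $[t_0,T]$ (which exist on the whole interval) of the Riccati equations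 $$-\dot\Sigma=\Sigma F+F^*\Sigma-\Sigma GQG^*\Sigma+H^*R^{-1}H,\quad \Sigma(T)=\Sigma_T;\qquad \dot\Pi=F\Pi+\Pi F^*-\Pi H^*R^{-1}H\Pi+GQG^*,\quad \Pi(t_0)=\Pi_0.$$ $\Phi_{F,\Sigma}(\tau,t)$ and $\Phi_{F,\Pi}(\tau,t)$ are the transition matrices ($\tau,t\in[t_0,T]$) defined by $$\partial_\tau\Phi_{F,\Sigma}(\tau,t)=(F-GQG^*\Sigma)(\tau)\,\Phi_{F,\Sigma}(\tau,t),\ \Phi_{F,\Sigma}(t,t)=\mathrm{Id};\qquad \partial_\tau\Phi_{F,\Pi}(\tau,t)=(F-\Pi H^*R^{-1}H)(\tau)\,\Phi_{F,\Pi}(\tau,t),\ \Phi_{F,\Pi}(t,t)=\mathrm{Id},$$ and $\Phi^*(\tau,t)$ denotes the transpose of $\Phi(\tau,t)$. *)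

(* Defs.v *)
From HB Require Import structures.
From mathcomp Require Import all_boot all_order all_algebra.
From mathcomp Require Import all_classical all_reals all_analysis.
Import Order.TTheory GRing.Theory Num.Theory.
Import numFieldNormedType.Exports.

Set Implicit Arguments.
Unset Strict Implicit.
Unset Printing Implicit Defensive.

Local Open Scope classical_set_scope.
Local Open Scope ring_scope.

(* Vectors of R^n and of its dual are column vectors 'cV_n.  Functions on an
   interval [a, b] are total functions on R of which only the values on [a, b]
   matter.  Elements of L^1 and L^2 are given by Borel measurable
   representatives, lebesgue_measure living on the Borel sets; every Lebesgue
   class has such a representative. *)

Section MatrixFunctions.
Variable R : realType.
Local Notation leb := (@lebesgue_measure R).

Definition L1mx (a b : R) p q (A : R -> 'M[R]_(p, q)) : Prop :=
  forall i j, leb.-integrable `[a, b] (fun t => (A t i j)%:E).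

Definition L2mx (a b : R) p q (A : R -> 'M[R]_(p, q)) : Prop :=
  forall i j, measurable_fun `[a, b] (fun t => A t i j) /\
    leb.-integrable `[a, b] (fun t => (A t i j ^+ 2)%:E).

Definition integral_mx (a b : R) p q (A : R -> 'M[R]_(p, q)) : 'M[R]_(p, q) :=
  \matrix_(i, j) (\int[leb]_(t in `[a, b]) A t i j).

(* The epsilon-delta definition; the finitely many subintervals [u i, v i] of [a, b]
   are required not to overlap. *)
Definition abs_continuous (a b : R) (f : R -> R) : Prop :=
  forall e : R, 0 < e -> exists2 d : R, 0 < d &
    forall (k : nat) (u v : 'I_k -> R),
      (forall i, a <= u i /\ u i <= v i /\ v i <= b) ->
      (forall i j, i != j -> v i <= u j \/ v j <= u i) ->
      \sum_(i < k) (v i - u i) < d ->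
      \sum_(i < k) `|f (v i) - f (u i)| < e.

(* dX/dt = Y a.e. on [a, b], with X absolutely continuous.  The derivative is
   the two-sided one: the endpoints form a null set, so the values of X outside
   [a, b] are irrelevant. *)
Definition ae_deriv (a b : R) p q (X Y : R -> 'M[R]_(p, q)) : Prop :=
  (forall i j, abs_continuous a b (fun t => X t i j)) /\
  {ae leb, forall t, t \in `[a, b] ->
    forall i j, is_derive t (1 : R) (fun u => X u i j) (Y t i j)}.

Definition psd p (A : 'M[R]_p) : Prop :=
  A^T = A /\ forall x : 'cV[R]_p, 0 <= (x^T *m A *m x) 0 0.

Definition psd_sqrt p (A S : 'M[R]_p) : Prop := psd S /\ S *m S = A.

Definition transition_mx (a b : R) p (A : R -> 'M[R]_p)
    (Phi : R -> R -> 'M[R]_p) : Prop :=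
  forall t, t \in `[a, b] ->
    ae_deriv a b (fun tau => Phi tau t) (fun tau => A tau *m Phi tau t) /\
    Phi t t = 1%:M.

End MatrixFunctions.

Section BoundaryValueProblem.
Variable R : realType.
Variables n m d : nat.
Variables (t0 T : R) (F : R -> 'M[R]_n) (G : R -> 'M[R]_(n, d)).
Variables (H : R -> 'M[R]_(m, n)) (Q : R -> 'M[R]_d) (Rm : R -> 'M[R]_m).
Variables Pi0 SigmaT : 'M[R]_n.
Local Notation leb := (@lebesgue_measure R).

Definition GQG (t : R) : 'M[R]_n := G t *m Q t *m (G t)^T.
Definition HRH (t : R) : 'M[R]_n := (H t)^T *m invmx (Rm t) *m H t.

Definition bvp_solution (lmu lnu mu nu : R -> 'cV[R]_n) : Prop :=
  [/\ ae_deriv t0 T mu (fun t => F t *m mu t - GQG t *m nu t + lmu t),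
      ae_deriv t0 T nu
        (fun t => - ((F t)^T *m nu t + HRH t *m mu t - lnu t)),
      mu t0 = - (Pi0 *m nu t0) &
      nu T = SigmaT *m mu T].

(* "The" solution is rendered as: a solution exists, and the identity holds for
   every solution.  The integrability clause gives meaning to the (otherwise
   total) integral. *)
Definition mu_kernel (K : R -> R -> 'M[R]_n) : Prop :=
  forall s, s \in `[t0, T] -> forall lnu, L2mx t0 T lnu ->
  [/\ L1mx t0 T (fun t => K s t *m lnu t),
      exists mu nu, bvp_solution (fun=> 0) lnu mu nu &
      forall mu nu, bvp_solution (fun=> 0) lnu mu nu ->
        mu s = integral_mx t0 T (fun t => K s t *m lnu t)].

Definition nu_kernel (L : R -> R -> 'M[R]_n) : Prop :=
  forall s, s \in `[t0, T] -> forall lmu, L2mx t0 T lmu ->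
  [/\ L1mx t0 T (fun t => L s t *m lmu t),
      exists mu nu, bvp_solution lmu (fun=> 0) mu nu &
      forall mu nu, bvp_solution lmu (fun=> 0) mu nu ->
        nu s = integral_mx t0 T (fun t => L s t *m lmu t)].

(* K0 satisfies P, and is the only kernel on [t0, T]^2 to do so when, for each
   s, the kernels are identified up to null sets in t. *)
Definition is_the_kernel (P : (R -> R -> 'M[R]_n) -> Prop)
    (K0 : R -> R -> 'M[R]_n) : Prop :=
  P K0 /\
  forall K, P K -> forall s, s \in `[t0, T] ->
    {ae leb, forall t, t \in `[t0, T] -> K s t = K0 s t}.

End BoundaryValueProblem.

(* Main.v *)
Require Import Defs.
From HB Require Import structures.
From mathcomp Require Import all_boot all_order all_algebra.
From mathcomp Require Import all_classical all_reals all_analysis.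
From mathcomp Require Import measurable_realfun.
From mathcomp Require Import ring lra.
Import Order.TTheory GRing.Theory Num.Theory.
Import numFieldNormedType.Exports.

Set Implicit Arguments.
Unset Strict Implicit.
Unset Printing Implicit Defensive.

Local Open Scope classical_set_scope.
Local Open Scope ring_scope.


(** Write [S] for G Q G^*, [N] for H^* R^-1 H, [A = F - S Sigma] and
[X t] for the transition matrix of [A] from [t0] to [t].

The Riccati solution decouples the boundary value problem.  When l_mu = 0, the
defect [w = nu - Sigma mu] of the terminal relation solves the backward adjoint
equation [w' = - A^* w + l] with [w T = 0] ([riccati_decoupling]), while
[mu' = A mu - S w].  In the moving coordinates [X^* w] and [z = X^-1 mu] both
equations become quadratures: with [g = X^* l] and [p t] the integral of [g] over
[[t, T]], one has [X^* w = - p] and [z' = W' p], where [W t] is the integral of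
[X^-1 S X^-*] over [[t0, t]].  The relation mu(t0) = - Pi0 nu(t0) reads
[z t0 = C p t0] with [C = Pi0^(1/2) (1 + Pi0^(1/2) Sigma(t0) Pi0^(1/2))^-1 Pi0^(1/2)]
([sandwich_solve]), which makes sense without inverting Pi0.  Integration by parts
gives [z s = C p(t0) + W s p s + (integral of W g over [t0, s])], and this is the
integral over [[t0, T]] of [(C + W (min s t)) g t] ([min_kernel_integral]).  Hence
the kernel is [X s (C + W (min s t)) (X t)^*], which is K because
[Phi s t = X s (X t)^-1].  No exchange of integrals is needed.  Read backwards, the
same formulas produce a solution for every forcing term.  A kernel is determined
almost everywhere by its action on indicator functions times basis vectors
([kernel_ae_unique]).  This is [state_kernel_formula].

The kernel Lambda comes from the same theorem by duality.  Time reversal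
[t |-> t0 + T - t] together with [(mu, nu) |-> (nu, - mu)] maps the problem with
l_nu = 0 to a problem with l_mu = 0 in which F becomes F^*, and the members of each
of the pairs (S, N), (Pi0, Sigma_T), (Sigma, Pi) are exchanged; the transition matrix
becomes [(tau, t) |-> Phi_{F,Pi} (reversed t, reversed tau)^*]
([costate_kernel_dual], [costate_kernel_formula]).

All equations hold almost everywhere with coefficients that are only integrable, so
the calculus rests on absolutely continuous functions.  Its two pillars are that an
absolutely continuous function with nonpositive derivative almost everywhere does not
increase ([abs_continuous_nonincreasing]), and that the indefinite integral of an
integrable function is absolutely continuous with the expected derivative
([abs_continuous_primitive], [is_derive_primitive]).  The first one yields a Gronwall
lemma, hence uniqueness for linear equations ([linear_ode_unique]), hence the
invertibility and the factorization of transition matrices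
([transition_mx_factor]). *)

(** * Absolutely continuous functions *)

Section AbsolutelyContinuous.
Variable R : realType.
Implicit Types (a b c M : R) (f g h : R -> R).

Lemma abs_continuousS a b c d f : a <= c -> d <= b ->
  abs_continuous a b f -> abs_continuous c d f.
Proof.
move=> ac db fAC e e0; have [dl dl0 H] := fAC e e0; exists dl => // k u v uv.
apply: H => i; have [? [? ?]] := uv i; split; first exact: le_trans ac _.
by split=> //; exact: le_trans db.
Qed.

(** The criterion behind the closure under sums, products, inverses and
exponentials. *)
Lemma abs_continuous_dominated a b M f g h :
  abs_continuous a b f -> abs_continuous a b g ->
  (forall u v, a <= u -> u <= v -> v <= b ->
    `|h v - h u| <= M * (`|f v - f u| + `|g v - g u|)) ->
  abs_continuous a b h.
Proof.
move=> fAC gAC hM e e0.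
(* [M] may be negative or zero. *)
pose K := `|M| + 1.
have K0 : 0 < K by rewrite ltr_pwDr.
have eK : 0 < e / K / 2 by rewrite !divr_gt0.
have [d1 d10 H1] := fAC _ eK; have [d2 d20 H2] := gAC _ eK.
exists (Num.min d1 d2); first by rewrite lt_min d10.
move=> k u v uv dis; rewrite lt_min => /andP[s1 s2].
have {}H1 := H1 k u v uv dis s1; have {}H2 := H2 k u v uv dis s2.
apply: (@le_lt_trans _ _ (\sum_(i < k) K * (`|f (v i) - f (u i)| +
    `|g (v i) - g (u i)|))).
  apply: ler_sum => i _; have [au [uvi vb]] := uv i.
  apply: le_trans (hM _ _ au uvi vb) _; rewrite ler_wpM2r// ?addr_ge0//.
  by rewrite /K (le_trans (ler_norm M))// lerDl.
rewrite -mulr_sumr big_split/= mulrC -ltr_pdivlMr//.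
by rewrite (splitr (e / K)) ltrD.
Qed.

Lemma abs_continuous_cst a b c : abs_continuous a b (fun=> c).
Proof.
move=> e e0; exists 1 => // k u v _ _ _.
by rewrite big1 // => i _; rewrite subrr normr0.
Qed.

Lemma abs_continuousD a b f g : abs_continuous a b f -> abs_continuous a b g ->
  abs_continuous a b (fun t => f t + g t).
Proof.
move=> fAC gAC; apply: (abs_continuous_dominated (M := 1) fAC gAC) => u v _ _ _.
by rewrite mul1r opprD addrACA ler_normD.
Qed.

Lemma abs_continuousN a b f : abs_continuous a b f ->
  abs_continuous a b (fun t => - f t).
Proof.
move=> fAC; apply: (abs_continuous_dominated (M := 1) fAC fAC) => u v _ _ _.
by rewrite mul1r -opprD normrN lerDl.
Qed.

(** Truncating at [s] is monotone and 1-Lipschitz, so it maps a family of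
nonoverlapping intervals to one of no larger total length. *)
Lemma abs_continuous_min a b s f : a <= s -> abs_continuous a b f ->
  abs_continuous a b (fun t => f (Num.min s t)).
Proof.
move=> sa fAC e e0; have [d d0 H] := fAC e e0; exists d => // k u v uv dis sd.
have min_mono x y : x <= y -> Num.min s x <= Num.min s y.
  by move=> xy; rewrite le_min ge_min lexx/= ge_min xy orbT.
apply: (H k (fun i => Num.min s (u i)) (fun i => Num.min s (v i))).
- move=> i; have [au [uvi vb]] := uv i.
  by rewrite le_min sa au min_mono// ge_min vb orbT.
- by move=> i j /dis[] /min_mono; [left|right].
apply: le_lt_trans sd; apply: ler_sum => i _; have [_ [uvi _]] := uv i.
by have [su|us] := leP s (u i); have [sv|vs] := leP s (v i); lra.
Qed.

Lemma abs_continuous_continuous a b f : abs_continuous a b f ->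
  {within `[a, b], continuous f}.
Proof.
move=> fAC; apply/subspace_continuousP => x /= /[!in_itv]/= /andP[ax xb].
apply/cvgrPdist_lt => e e0; have [d d0 H] := fAC e e0.
rewrite near_withinE; near=> y => /=; rewrite in_itv/= => /andP[ay yb].
have yd : `|x - y| < d by near: y; apply: cvgr_dist_lt => //; exact: cvg_id.
have [xy|/ltW yx] := leP x y.
  have := H 1%N (fun=> x) (fun=> y); rewrite !big_ord1 distrC; apply => //.
    by move=> i j /negP[]; rewrite !ord1.
  by rewrite -(ger0_norm (x := y - x)) ?subr_ge0// distrC.
have := H 1%N (fun=> y) (fun=> x); rewrite !big_ord1; apply => //.
  by move=> i j /negP[]; rewrite !ord1.
by rewrite -(ger0_norm (x := x - y)) ?subr_ge0.
Unshelve. all: by end_near. Qed.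

Lemma abs_continuous_measurable a b f : abs_continuous a b f ->
  measurable_fun `[a, b] f.
Proof.
by move=> /abs_continuous_continuous; exact: subspace_continuous_measurable_fun.
Qed.

Lemma abs_continuous_bounded a b f : abs_continuous a b f ->
  exists2 M, 0 < M & forall t, t \in `[a, b] -> `|f t| <= M.
Proof.
move=> /abs_continuous_continuous fc.
have := @segment_compact _ a b => /(continuous_compact fc).
move=> /compact_bounded[M [_ HM]]; exists (`|M| + 1); first by rewrite ltr_pwDr.
move=> t tab; apply: HM; last by exists t.
by rewrite (le_lt_trans (ler_norm M))// ltrDl.
Qed.

Lemma abs_continuousM a b f g : abs_continuous a b f -> abs_continuous a b g ->
  abs_continuous a b (fun t => f t * g t).
Proof.
move=> fAC gAC.
have [M1 M10 H1] := abs_continuous_bounded fAC.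
have [M2 M20 H2] := abs_continuous_bounded gAC.
apply: (abs_continuous_dominated (M := M1 + M2) fAC gAC) => u v au uv vb.
have -> : f v * g v - f u * g u = f v * (g v - g u) + (f v - f u) * g u by ring.
apply: (le_trans (ler_normD _ _)); rewrite !normrM.
have {}H1 : `|f v| <= M1 by apply: H1; rewrite in_itv/= vb (le_trans au).
have {}H2 : `|g u| <= M2 by apply: H2; rewrite in_itv/= au (le_trans uv).
have := normr_ge0 (f v - f u); have := normr_ge0 (g v - g u).
by move: `|f v - f u| `|g v - g u| => x y x0 y0; nra.
Qed.

Lemma abs_continuous_sum (I : Type) (s : seq I) (P : pred I) (F : I -> R -> R) a b :
  (forall i, abs_continuous a b (F i)) ->
  abs_continuous a b (fun t => \sum_(i <- s | P i) F i t).
Proof.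
move=> FAC; elim: s => [|i s IH].
  by under [X in abs_continuous _ _ X]funext do rewrite big_nil;
    exact: abs_continuous_cst.
under [X in abs_continuous _ _ X]funext do rewrite big_cons.
by case: (P i) => //; exact: abs_continuousD (FAC i) IH.
Qed.

Lemma abs_continuous_prod (I : Type) (s : seq I) (P : pred I) (F : I -> R -> R) a b :
  (forall i, abs_continuous a b (F i)) ->
  abs_continuous a b (fun t => \prod_(i <- s | P i) F i t).
Proof.
move=> FAC; elim: s => [|i s IH].
  by under [X in abs_continuous _ _ X]funext do rewrite big_nil;
    exact: abs_continuous_cst.
under [X in abs_continuous _ _ X]funext do rewrite big_cons.
by case: (P i) => //; exact: abs_continuousM (FAC i) IH.
Qed.

(** By compactness [f] stays away from 0, and inversion is Lipschitz there. *)
Lemma abs_continuousV a b f : (forall t, t \in `[a, b] -> f t != 0) ->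
  abs_continuous a b f -> abs_continuous a b (fun t => (f t)^-1).
Proof.
move=> f0 fAC; have [ab|ba] := leP a b; last first.
  move=> e e0; exists 1 => // -[|k] u v uv _ _; first by rewrite big_ord0.
  have [au [uv0 vb]] := uv ord0.
  by have := lt_le_trans ba (le_trans au (le_trans uv0 vb)); rewrite ltxx.
have cf : {within `[a, b], continuous (fun t => `|f t|)}.
  have /subspace_continuousP fc := abs_continuous_continuous fAC.
  by apply/subspace_continuousP => x xI; exact: (cvg_norm (fc x xI)).
have [c cab cmin] := EVT_min ab cf.
pose m := `|f c|; have m0 : 0 < m by rewrite normr_gt0 f0.
apply: (abs_continuous_dominated (M := m^-1 ^+ 2) fAC fAC) => u v au uv vb.
have uI : u \in `[a, b] by rewrite in_itv/= au (le_trans uv).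
have vI : v \in `[a, b] by rewrite in_itv/= vb (le_trans au).
have -> : (f v)^-1 - (f u)^-1 = (f u - f v) * ((f v)^-1 * (f u)^-1).
  by have := f0 _ uI; have := f0 _ vI => ? ?; field; apply/andP.
rewrite normrM mulrC; apply: ler_pM => //; last by rewrite distrC lerDl.
rewrite normrM !normfV expr2 ler_pM// lef_pV2 ?posrE ?normr_gt0 ?f0//; exact: cmin.
Qed.

End AbsolutelyContinuous.

(** * Monotonicity from the sign of the derivative *)

Section Monotonicity.
Variable R : realType.
Local Notation leb := (@lebesgue_measure R).
Implicit Types (a b : R) (f : R -> R).

Let leb_le (A B : set R) : measurable A -> measurable B -> A `<=` B ->
  (leb A <= leb B)%E.
Proof. by move=> mA mB; apply: (@le_measure _ _ _ leb); rewrite inE. Qed.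

Let leb_setU (A B : set R) : measurable A -> measurable B -> A `&` B = set0 ->
  leb (A `|` B) = (leb A + leb B)%E.
Proof. by move=> mA mB AB; exact: (@measureU _ _ _ leb). Qed.

(** Unlike indexed families, lists of intervals can be built one interval at a time,
as the proof of [abs_continuous_nonincreasing] does. *)
Lemma abs_continuous_seq a b f e : abs_continuous a b f -> 0 < e ->
  exists2 d, 0 < d & forall s : seq (R * R),
    all (fun p => [&& a <= p.1, p.1 <= p.2 & p.2 <= b]) s ->
    pairwise (fun p q => q.2 <= p.1) s ->
    \sum_(p <- s) (p.2 - p.1) < d ->
    \sum_(p <- s) `|f p.2 - f p.1| < e.
Proof.
move=> fAC /fAC[d d0 H]; exists d => // s /all_nthP sab /(pairwiseP (0, 0)) sdis.
rewrite !(big_nth (0, 0)) !big_mkord => sd.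
apply: (H _ (fun i => (nth (0, 0) s i).1) (fun i => (nth (0, 0) s i).2)) => //.
  by move=> i; have /and3P[] := sab (0, 0) i (ltn_ord i).
move=> i j ij; case: (ltngtP i j) => [lij|lji|/val_inj eij].
- by right; apply: sdis => //; rewrite inE.
- by left; apply: sdis => //; rewrite inE.
- by rewrite eij eqxx in ij.
Qed.

Lemma is_derive_increment (f : R -> R) (t d e : R) : is_derive t 1 f d -> 0 < e ->
  exists2 r, 0 < r & forall u, `|u - t| < r ->
    `|f u - f t - d * (u - t)| <= e * `|u - t|.
Proof.
move=> [fd fE] e0.
have : h^-1 *: (f (h *: 1 + t) - f t) @[h --> 0^'] --> d by rewrite -fE.
move=> /cvgrPdist_le/(_ e e0) [/= r r0 H]; exists r => // u ur.
have [->|ut] := eqVneq u t; first by rewrite !subrr mulr0 subrr !normr0 mulr0.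
have ut0 : u - t != 0 by rewrite subr_eq0.
have := H (u - t); rewrite /= sub0r normrN => /(_ ur ut0).
rewrite /GRing.scale/= mulr1 subrK.
have -> : d - (u - t)^-1 * (f u - f t) = - ((u - t)^-1 * (f u - f t - d * (u - t))).
  by field.
by rewrite normrN normrM normfV ler_pdivrMl ?normr_gt0// [X in _ <= X]mulrC.
Qed.

Lemma negligible_open_cover (N : set R) d : leb.-negligible N -> 0 < d ->
  exists U : set R, [/\ open U, N `<=` U & (leb U < d%:E)%E].
Proof.
move=> [A [mA A0 NA]] d0.
have Afin : (leb A < +oo)%E by rewrite A0.
have [U [oU AU Ud]] := lebesgue_regularity_outer mA Afin d0.
exists U; split=> //; first exact: subset_trans NA AU.
have mU : measurable U by exact: open_measurable.
suff -> : leb U = leb (U `\` A) by [].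
rewrite -(add0e (leb (U `\` A))) -A0 -{1}(setDUK AU); apply: leb_setU => //.
  exact: measurableD.
by rewrite setDE setICA setICr setI0.
Qed.

(** Cover the exceptional null set by an open set [U] of measure less than the
[dl] given by absolute continuity.  Starting from [a], one can pass over any point
[c] of the segment by a short step: if [c] lies in [U], the step stays in [U] and
is recorded in a list; otherwise the derivative at [c] is nonpositive and [f]
increases by at most [e] times the length of the step.  A supremum argument
reaches [b].  The recorded intervals have total length less than [dl], so they
contribute at most [e]. *)
Lemma abs_continuous_nonincreasing a b f : a <= b -> abs_continuous a b f ->
  {ae leb, forall t, t \in `[a, b] -> exists2 d, is_derive t 1 f d & d <= 0} ->
  f b <= f a.
Proof.
move=> ab fAC fd.
suff H e : 0 < e -> f b - f a <= e * (b - a + 1).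
  rewrite -subr_le0; apply/ler_addgt0Pl => e e0.
  have c0 : 0 < b - a + 1 by rewrite ltr_wpDl ?subr_ge0.
  rewrite addr0; have := H _ (divr_gt0 e0 c0).
  by rewrite divfK// gt_eqF.
move=> e0; have [dl dl0 Hdl] := abs_continuous_seq fAC e0.
have [U [oU NU Udl]] := negligible_open_cover fd dl0.
have mU : measurable U by exact: open_measurable.
(* [lam x] is the measure of the part of [U] before [x]; it bounds the total length
   of the intervals recorded up to [x]. *)
pose lam (x : R) := fine (leb (U `&` `[a, x])).
have mUx x : measurable (U `&` `[a, x]) by apply: measurableI.
have Ux x : (leb (U `&` `[a, x]) <= leb U)%E.
  by apply: leb_le => //; exact: subIsetl.
have Uxfin x : leb (U `&` `[a, x]) \is a fin_num.
  rewrite ge0_fin_numE//; apply: le_lt_trans (Ux x) _.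
  by apply: lt_trans Udl _; rewrite ltry.
pose S (x : R) := exists s : seq (R * R),
  [/\ all (fun p => [&& a <= p.1, p.1 <= p.2 & p.2 <= x]) s,
      pairwise (fun p q => q.2 <= p.1) s,
      \sum_(p <- s) (p.2 - p.1) <= lam x &
      f x - f a <= e * (x - a) + \sum_(p <- s) `|f p.2 - f p.1|].
have lam_mono x y : x <= y -> lam x <= lam y.
  move=> xy; rewrite fine_le//; apply: leb_le => //.
  by apply: setIS; apply: subset_itvl; rewrite bnd_simp.
have extend_regular x y : x <= y -> f y - f x <= e * (y - x) -> S x -> S y.
  move=> xy fxy [s [s1 s2 s3 s4]]; exists s; split=> //.
  - apply: sub_all s1 => p /and3P[-> -> px]; exact: le_trans px xy.
  - exact: le_trans s3 (lam_mono _ _ xy).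
  - by lra.
have extend_cover x y : a <= x -> x <= y -> `[x, y] `<=` U -> S x -> S y.
  move=> ax xy xyU [s [s1 s2 s3 s4]]; exists ((x, y) :: s); split=> /=.
  - rewrite ax xy lexx/=; apply: sub_all s1 => p /and3P[-> -> px].
    exact: le_trans px xy.
  - by rewrite s2 andbT; apply: sub_all s1 => p /and3P[_ _ ->].
  - rewrite big_cons/=.
    suff : y - x + lam x <= lam y by apply: le_trans; rewrite lerD2l.
    have E : leb `]x, y] = (y - x)%:E.
      rewrite lebesgue_measure_itv/= lte_fin; case: ltgtP xy => // -> _.
      by rewrite subrr.
    rewrite -lee_fin EFinD /lam !fineK// -E addeC -leb_setU//.
      apply: leb_le => //; first exact: measurableU.
      move=> z [[Uz]|]; rewrite /= in_itv/= => /andP[z1 z2].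
        by split=> //=; rewrite in_itv/= z1 (le_trans z2).
      split; first by apply: xyU; rewrite /= in_itv/= (ltW z1).
      by rewrite /= in_itv/= z2 (le_trans ax) ?ltW.
    apply/seteqP; split=> // z [[_]]; rewrite /= !in_itv/= => /andP[_ zx] /andP[xz _].
    by move: (lt_le_trans xz zx); rewrite ltxx.
  - rewrite big_cons/=.
    have := ler_norm (f y - f x).
    have : 0 <= e * (y - x) by rewrite mulr_ge0 ?subr_ge0// ltW.
    by lra.
have local c : c \in `[a, b] -> exists2 r, 0 < r &
    forall x y, a <= x -> x <= c -> c <= y -> y <= b -> c - x < r -> y - c < r -> S x -> S y.
  move=> cab; have [Uc|nUc] := pselect (U c).
    have /nbhs_ballP[r /= r0 rU] : nbhs c U by exact: open_nbhs_nbhs.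
    exists r => // x y ax xc cy yb xr yr; apply: extend_cover => //.
      exact: le_trans xc cy.
    move=> z; rewrite /= in_itv/= => /andP[xz zy]; apply: rU.
    by rewrite /ball/= ltr_norml; apply/andP; split; lra.
  have [d fdc d0] : exists2 d, is_derive c 1 f d & d <= 0.
    by apply: contrapT => nd; apply: nUc; apply: NU => /(_ cab).
  have [r r0 H] := is_derive_increment fdc e0; exists r => // x y ax xc cy yb xr yr.
  apply: extend_regular; first exact: le_trans xc cy.
  have := H y; rewrite ger0_norm ?subr_ge0// => /(_ yr); rewrite ler_norml => /andP[_ H1].
  have := H x; rewrite ler0_norm ?subr_le0// opprB => /(_ xr).
  rewrite ler_norml => /andP[H2 _].
  have : d * (y - x) <= 0 by rewrite mulr_le0_ge0// subr_ge0 (le_trans xc).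
  by lra.
have Sa : S a by exists [::]; split; rewrite ?big_nil ?fine_ge0// !subrr mulr0 addr0.
suff [s [s1 s2 s3 s4]] : S b.
  have := Hdl s s1 s2; have -> : \sum_(p <- s) (p.2 - p.1) < dl.
    apply: le_lt_trans s3 _; rewrite -lte_fin /lam fineK//.
    exact: le_lt_trans (Ux b) Udl.
  by move=> /(_ isT); lra.
pose E := [set x | a <= x <= b /\ S x].
have Ea : E a by split=> //; rewrite lexx.
have Eb : ubound E b by move=> x [/andP[]].
have supE : has_sup E by split; [exists a|exists b].
pose c := sup E.
have le_c x : E x -> x <= c by move=> Ex; exact: (sup_upper_bound supE Ex).
have ac : a <= c by exact: le_c.
have cb : c <= b by apply: ge_sup => //; exists a.
have cab : c \in `[a, b] by rewrite in_itv/= ac.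
have [r r0 H] := local c cab.
have [x [/andP[ax xb] Sx] cx] := sup_adherent r0 supE.
have xc : x <= c by apply: le_c; split; [rewrite ax|].
have xr : c - x < r by rewrite ltrBlDr addrC -ltrBlDr.
have [cb'|bc] := ltP c b; last first.
  by apply: (H x) => //; apply: le_lt_trans r0; rewrite subr_le0.
(* a step of length at most [r / 2] beyond [c] that stays in the segment *)
pose y := Num.min (c + r / 2) b.
have cy : c < y by rewrite lt_min cb' ltrDl divr_gt0.
suff : y <= c by rewrite leNgt cy.
have yb : y <= b by rewrite ge_min lexx orbT.
have yr : y <= c + r / 2 by rewrite ge_min lexx.
apply: le_c; split; first by rewrite yb (le_trans ac)// ltW.
by apply: (H x) => //; [exact: ltW|lra].
Qed.
End Monotonicity.

(** * Indefinite integrals *)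

Lemma lebesgue_ae_filter (R : realType) :
  Filter (almost_everywhere (@lebesgue_measure R)).
Proof. exact: ae_filter_ringOfSetsType. Qed.
#[global] Existing Instance lebesgue_ae_filter.

Section Primitives.
Variable R : realType.
Local Notation leb := (@lebesgue_measure R).
Implicit Types (a b c : R) (f g : R -> R).

Let integrable_zero_ext a b g : leb.-integrable `[a, b] (EFin \o g) ->
  leb.-integrable setT (EFin \o (g \_ `[a, b])).
Proof.
move=> ig; rewrite -restrict_EFin.
by apply: (integrable_mkcond (mu := leb) _ _).1 => //; exact: measurable_itv.
Qed.

Lemma integrable_subitv a b c d g : a <= c -> d <= b ->
  leb.-integrable `[a, b] (EFin \o g) -> leb.-integrable `[c, d] (EFin \o g).
Proof.
move=> ac db; apply: integrableS => //.
by apply: subset_itvScc; rewrite bnd_simp.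
Qed.

Lemma Rintegral_itv_split a b c g : a <= c -> c <= b ->
  leb.-integrable `[a, b] (EFin \o g) ->
  \int[leb]_(x in `[a, b]) g x =
  \int[leb]_(x in `[a, c]) g x + \int[leb]_(x in `[c, b]) g x.
Proof.
move=> ac cb ig; apply/eqP; rewrite addrC -subr_eq; apply/eqP.
rewrite Rintegral_itvB ?bnd_simp// Rintegral_itv_obnd_cbnd//.
by apply: integrableS ig => //; apply: subset_itvr; rewrite bnd_simp.
Qed.

(** Absolute continuity of the integral, for the union of the intervals. *)
Lemma integral_disjoint_itv_small a b g e :
  leb.-integrable `[a, b] (EFin \o g) -> 0 < e ->
  exists2 d, 0 < d & forall (k : nat) (u v : 'I_k -> R),
    (forall i, u i <= v i) ->
    (forall i j, i != j -> v i <= u j \/ v j <= u i) ->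
    \sum_(i < k) (v i - u i) < d ->
    \sum_(i < k) (\int[leb]_(x in `]u i, v i]) `|(g \_ `[a, b]) x|) < e.
Proof.
move=> ig e0; have ih := integrable_zero_ext ig.
set h := g \_ _ in ih *.
have [d [d0 Hd]] := integral_normr_continuous ih e0; exists d => // k u v uv dis sd.
pose F (i : 'I_k) : set (measurableTypeR R) := [set` `]u i, v i]].
have mF i : measurable (F i) by exact: measurable_itv.
have tF : trivIset [set` index_enum 'I_k] F.
  apply/trivIsetP => i j _ _ ij; apply/seteqP; split=> // x [].
  rewrite /F/= !in_itv/= => /andP[ux xv] /andP[ux' xv'].
  have [vu|vu] := dis i j ij.
    by have := lt_le_trans ux' (le_trans xv vu); rewrite ltxx.
  by have := lt_le_trans ux (le_trans xv' vu); rewrite ltxx.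
have us : uniq (index_enum 'I_k) := index_enum_uniq _.
have mh (D : set (measurableTypeR R)) : measurable D ->
    measurable_fun D (fun x : measurableTypeR R => (`|h x|)%:E).
  move=> mD; apply/measurable_EFinP/measurableT_comp => //.
  by move/measurable_int/measurable_EFinP : ih; apply: measurable_funS.
have mD : measurable (\big[setU/set0]_(i <- index_enum 'I_k) F i).
  exact: bigsetU_measurable.
have intF i : (\int[leb]_(x in F i) (`|h x|)%:E)%E \is a fin_num.
  apply: integrable_fin_num => //; apply: (integrableS measurableT) => //.
  exact: integrable_norm.
have /= E := ge0_integral_bigsetU leb mF us tF (mh _ mD) _.
have small : (leb (\big[setU/set0]_(i <- index_enum 'I_k) F i) < d%:E)%E.
  have := ge0_integral_bigsetU leb mF us tF (f := cst 1%:E).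
  move=> /(_ (measurable_cst _) (fun _ _ => lee01)).
  rewrite integral_cst// mul1e => ->.
  rewrite (eq_bigr (fun i => (v i - u i)%:E)) ?sumEFin ?lte_fin// => i _.
  rewrite integral_cst// mul1e; transitivity (leb `]u i, v i]) => //.
  rewrite lebesgue_measure_itv/= lte_fin.
  by case: ltgtP (uv i) => // -> _; rewrite subrr.
have := Hd _ mD small.
rewrite /Rintegral E// (eq_bigr (fun i => (fine (\int[leb]_(x in F i) (`|h x|)%:E)%E)%:E)).
  by rewrite sumEFin.
by move=> i _; rewrite fineK.
Qed.

Lemma abs_continuous_primitive a b g : leb.-integrable `[a, b] (EFin \o g) ->
  abs_continuous a b (fun t => \int[leb]_(x in `[a, t]) g x).
Proof.
move=> ig e e0; have [d d0 H] := integral_disjoint_itv_small ig e0.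
exists d => // k u v uv dis sd; apply: le_lt_trans (H k u v _ dis sd); last first.
  by move=> i; have [_ []] := uv i.
apply: ler_sum => i _; have [au [uvi vb]] := uv i.
rewrite Rintegral_itvB ?bnd_simp//; last exact: integrable_subitv ig.
have iuv : leb.-integrable `]u i, v i] (EFin \o g).
  by apply: integrableS ig => //; apply: subset_itvScc; rewrite bnd_simp.
apply: le_trans (le_normr_Rintegral _ iuv) _ => //.
rewrite le_eqVlt; apply/orP; left; apply/eqP; apply: eq_Rintegral => x.
rewrite inE/= in_itv/= => /andP[ux xv]; rewrite patchE mem_set//=.
by rewrite in_itv/= (le_trans xv vb) andbT (le_trans au (ltW ux)).
Qed.

Lemma ae_not_endpoint a : {ae leb, forall t, t != a}.
Proof.
exists [set a]; split=> //; first exact: lebesgue_measure_set1.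
by move=> x /= /negP; rewrite negbK => /eqP.
Qed.

Lemma near_in_itvoo a b t : a < t -> t < b -> \forall u \near t, u \in `[a, b].
Proof.
move=> at' tb; near=> u; rewrite in_itv/=; apply/andP; split; apply: ltW.
  by near: u; exact: lt_nbhsr.
by near: u; exact: lt_nbhsl.
Unshelve. all: by end_near. Qed.

(** Lebesgue differentiation applies to the extension of [g] by 0, whose indefinite
integral agrees with that of [g] near every interior point. *)
Lemma is_derive_primitive a b g : leb.-integrable `[a, b] (EFin \o g) ->
  {ae leb, forall t, t \in `[a, b] ->
    is_derive t 1 (fun u => \int[leb]_(x in `[a, u]) g x) (g t)}.
Proof.
move=> ig; have ih := integrable_zero_ext ig.
have ihy (y : R) : leb.-integrable [set` Interval (BLeft a) (BRight y)]
    (EFin \o (g \_ `[a, b])).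
  exact: (integrableS measurableT).
have lh : locally_integrable [set: R] (g \_ `[a, b]).
  by apply: integrable_locally => //; exact: ig.
have := FTC1 ihy lh; have := ae_not_endpoint a; have := ae_not_endpoint b.
apply: filterS3 => t tb ta; rewrite in_itv/= => + /andP[at' tb'].
have ltb : t < b by rewrite lt_neqAle tb.
have lat : a < t by rewrite lt_neqAle eq_sym ta.
rewrite lte_fin => /(_ lat)[dt dE].
have -> : g t = (g \_ `[a, b]) t by rewrite patchE mem_set//= in_itv/= at'.
rewrite -dE derive1E.
apply: (@near_eq_is_derive _ _ _
  (fun u => \int[leb]_(x in `[a, u]) (g \_ `[a, b]) x)); last exact: derivableP.
near=> u; apply: eq_Rintegral => x; rewrite inE/= in_itv/= => /andP[ax xu].
rewrite patchE mem_set//= in_itv/= ax/= (le_trans xu)//; apply: ltW.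
by near: u; exact: lt_nbhsl.
Unshelve. all: by end_near. Qed.

End Primitives.

(** * Gronwall's lemma and almost everywhere matrix calculus *)

Section ScalarGronwall.
Variable R : realType.
Local Notation leb := (@lebesgue_measure R).
Implicit Types (a b c : R) (f g h k : R -> R).

Lemma expR_dist_le (M x y : R) : x <= M -> y <= M ->
  `|expR x - expR y| <= expR M * `|x - y|.
Proof.
wlog xy : x y / x <= y => [H xM yM|xM yM].
  have [xy|/ltW yx] := leP x y; first exact: H.
  by rewrite distrC [`|x - y|]distrC H.
rewrite distrC [`|x - y|]distrC !ger0_norm ?subr_ge0 ?ler_expR//.
apply: (@le_trans _ _ (expR y * (y - x))); last first.
  by rewrite ler_wpM2r ?subr_ge0// ler_expR.
have -> : expR x = expR y * expR (x - y) by rewrite -expRD addrC subrK.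
rewrite -[X in X - _]mulr1 -mulrBr ler_wpM2l ?expR_ge0//.
have := expR_ge1Dx (x - y); by lra.
Qed.

Lemma abs_continuous_expR a b f : abs_continuous a b f ->
  abs_continuous a b (fun t => expR (f t)).
Proof.
move=> fAC; have [M M0 HM] := abs_continuous_bounded fAC.
apply: (abs_continuous_dominated (M := expR M) fAC fAC) => u v au uv vb.
apply: le_trans (expR_dist_le (M := M) _ _) _.
- by rewrite (le_trans (ler_norm _))// HM// in_itv/= vb (le_trans au).
- by rewrite (le_trans (ler_norm _))// HM// in_itv/= au (le_trans uv).
by rewrite ler_wpM2l ?expR_ge0// lerDl.
Qed.

(** The integrating factor argument: the derivative of [f e^h] is
[(f' + f h') e^h]. *)
Lemma abs_continuous_expR_nonincreasing a b f h : a <= b ->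
  abs_continuous a b f -> abs_continuous a b h ->
  {ae leb, forall t, t \in `[a, b] -> exists df dh,
    [/\ is_derive t 1 f df, is_derive t 1 h dh & df + f t * dh <= 0]} ->
  f b * expR (h b) <= f a * expR (h a).
Proof.
move=> ab fAC hAC H.
apply: (abs_continuous_nonincreasing (f := fun t => f t * expR (h t))) => //.
  by apply: abs_continuousM => //; exact: abs_continuous_expR.
apply: filterS H => t H tab; have [df [dh [Df Dh dle]]] := H tab.
have De : is_derive t 1 (fun u => expR (h u)) (expR (h t) * dh).
  exact: (@is_derive1_comp _ expR h).
exists (f t *: (expR (h t) * dh) + expR (h t) *: df).
  exact: (@is_deriveM _ _ f (fun u => expR (h u))).
rewrite /GRing.scale/= mulrCA -mulrDr addrC mulr_ge0_le0 ?expR_ge0//.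
Qed.

(** To the right of [c] use the integrating factor [e^(-K)] on [f], to its left
[e^K] on [- f], where [K] is the indefinite integral of [k]. *)
Lemma gronwall_zero a b c f k : c \in `[a, b] -> abs_continuous a b f ->
  (forall t, 0 <= f t) -> f c = 0 -> leb.-integrable `[a, b] (EFin \o k) ->
  {ae leb, forall t, t \in `[a, b] ->
    exists2 d, is_derive t 1 f d & `|d| <= k t * f t} ->
  forall t, t \in `[a, b] -> f t = 0.
Proof.
rewrite in_itv/= => /andP[ac cb] fAC f0 fc ik Hd t /[!in_itv]/= /andP[at' tb].
pose K t := \int[leb]_(x in `[a, t]) k x.
have KAC : abs_continuous a b K by exact: abs_continuous_primitive.
have DK := is_derive_primitive ik.
apply/eqP; rewrite eq_le f0 andbT; have [ct|/ltW tc] := leP c t.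
  have := @abs_continuous_expR_nonincreasing c t f (fun t => - K t) ct.
  rewrite fc mul0r pmulr_lle0 ?expR_gt0//; apply.
  - exact: abs_continuousS fAC.
  - by apply: abs_continuousN; exact: abs_continuousS KAC.
  apply: filterS2 DK Hd => x DK Hd; rewrite in_itv/= => /andP[cx xt].
  have xab : x \in `[a, b] by rewrite in_itv/= (le_trans ac) ?(le_trans xt).
  have [d Df dk] := Hd xab; exists d, (- k x); split=> //.
    exact: (@is_deriveN _ _ _ K _ _ _ (DK xab)).
  by rewrite mulrN subr_le0 mulrC (le_trans (ler_norm _)).
have := @abs_continuous_expR_nonincreasing t c (fun t => - f t) K tc.
rewrite fc oppr0 mul0r mulNr oppr_ge0 pmulr_lle0 ?expR_gt0//; apply.
- by apply: abs_continuousN; exact: abs_continuousS fAC.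
- exact: abs_continuousS KAC.
apply: filterS2 DK Hd => x DK Hd; rewrite in_itv/= => /andP[tx xc].
have xab : x \in `[a, b] by rewrite in_itv/= (le_trans at') ?(le_trans xc).
have [d Df dk] := Hd xab; exists (- d), (k x); split=> //; last 2 first.
- exact: DK.
- by move: dk; rewrite ler_norml mulrC => /andP[]; lra.
exact: is_deriveN.
Qed.

End ScalarGronwall.

Section MatrixCalculus.
Variable R : realType.
Local Notation leb := (@lebesgue_measure R).
Implicit Types (a b c : R).

Lemma is_derive_sum_fun (I : finType) (F : I -> R -> R) (t : R) (d : I -> R) :
  (forall i, is_derive t 1 (F i) (d i)) ->
  is_derive t 1 (fun u => \sum_i F i u) (\sum_i d i).
Proof.
move=> dF; have -> : (fun u => \sum_i F i u) = \sum_i F i.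
  by apply/funext => u; rewrite fct_sumE.
by elim/big_ind2 : _ => // [|] *; [exact: is_derive_cst|exact: is_deriveD].
Qed.

Lemma derivable_sum_fun (I : Type) (s : seq I) (P : pred I) (F : I -> R -> R) (t : R) :
  (forall i, derivable (F i) t 1) ->
  derivable (fun u => \sum_(i <- s | P i) F i u) t 1.
Proof.
move=> dF; elim: s => [|i s IH].
  by under [X in derivable X]funext do rewrite big_nil; exact: derivable_cst.
under [X in derivable X]funext do rewrite big_cons.
by case: (P i) => //; exact: derivableD (dF i) IH.
Qed.

Lemma derivable_prod_fun (I : Type) (s : seq I) (P : pred I) (F : I -> R -> R) (t : R) :
  (forall i, derivable (F i) t 1) ->
  derivable (fun u => \prod_(i <- s | P i) F i u) t 1.
Proof.
move=> dF; elim: s => [|i s IH].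
  by under [X in derivable X]funext do rewrite big_nil; exact: derivable_cst.
under [X in derivable X]funext do rewrite big_cons.
by case: (P i) => //; exact: derivableM (dF i) IH.
Qed.

(** The pointwise part of [ae_deriv]. *)
Definition mx_is_derive p q (t : R) (X : R -> 'M[R]_(p, q)) (Y : 'M[R]_(p, q)) :=
  forall i j, is_derive t 1 (fun u => X u i j) (Y i j).

Lemma mx_is_deriveM p q r t (X : R -> 'M[R]_(p, q)) X' (Z : R -> 'M[R]_(q, r)) Z' :
  mx_is_derive t X X' -> mx_is_derive t Z Z' ->
  mx_is_derive t (fun u => X u *m Z u) (X' *m Z t + X t *m Z').
Proof.
move=> dX dZ i j.
have -> : (fun u => (X u *m Z u) i j) = (fun u => \sum_k X u i k * Z u k j).
  by apply/funext => u; rewrite mxE.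
rewrite !mxE -big_split/=; apply: is_derive_sum_fun => k.
apply: is_derive_eq.
  exact: (@is_deriveM _ _ (fun u => X u i k) (fun u => Z u k j) _ _ _ _ (dX i k) (dZ k j)).
by rewrite /GRing.scale/= addrC; congr (_ + _); exact: mulrC.
Qed.

Lemma mx_is_derive_near p q (t : R) (X Z : R -> 'M[R]_(p, q)) Y :
  (\near t, X t = Z t) -> mx_is_derive t X Y -> mx_is_derive t Z Y.
Proof.
move=> XZ dX i j; apply: near_eq_is_derive (dX i j).
by apply: filterS XZ => u ->.
Qed.

Lemma mx_is_derive_unique p q t (X : R -> 'M[R]_(p, q)) Y Z :
  mx_is_derive t X Y -> mx_is_derive t X Z -> Y = Z.
Proof.
move=> dY dZ; apply/matrixP => i j.
by have [_ <-] := dY i j; have [_ <-] := dZ i j.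
Qed.

Lemma derivable_det p t (X : R -> 'M[R]_p) :
  (forall i j, derivable (fun u => X u i j) t 1) ->
  derivable (fun u => \det (X u)) t 1.
Proof.
move=> dX; apply: derivable_sum_fun => s; apply: derivableM => //.
exact: derivable_prod_fun.
Qed.

Lemma abs_continuous_det p a b (X : R -> 'M[R]_p) :
  (forall i j, abs_continuous a b (fun t => X t i j)) ->
  abs_continuous a b (fun t => \det (X t)).
Proof.
move=> dX; apply: abs_continuous_sum => s; apply: abs_continuousM.
  exact: abs_continuous_cst.
exact: abs_continuous_prod.
Qed.

Lemma invmx_entryE p (A : 'M[R]_p) i j : A \in unitmx ->
  invmx A i j = (\det A)^-1 * cofactor A j i.
Proof. by move=> uA; rewrite /invmx uA !mxE. Qed.

Lemma abs_continuous_eq a b (f g : R -> R) :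
  (forall t, t \in `[a, b] -> f t = g t) -> abs_continuous a b f ->
  abs_continuous a b g.
Proof.
move=> fg fAC; apply: (abs_continuous_dominated (M := 1) fAC fAC) => u v au uv vb.
rewrite -!fg ?mul1r ?lerDl// in_itv/=; first by rewrite au (le_trans uv).
by rewrite vb (le_trans au).
Qed.

Lemma ae_deriv_eqr p q a b (X Y Z : R -> 'M[R]_(p, q)) :
  {ae leb, forall t, t \in `[a, b] -> Y t = Z t} ->
  ae_deriv a b X Y -> ae_deriv a b X Z.
Proof.
move=> YZ [XAC dX]; split=> //; apply: filterS2 YZ dX => t YZ dX tab i j.
by rewrite -YZ//; exact: dX.
Qed.

(** The endpoints form a null set, so almost everywhere statements need only be
proved at points with a neighbourhood inside the segment. *)
Lemma ae_interior a b (P : R -> Prop) :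
  {ae leb, forall t, t \in `[a, b] -> (\forall u \near t, u \in `[a, b]) -> P t} ->
  {ae leb, forall t, t \in `[a, b] -> P t}.
Proof.
have := ae_not_endpoint b; have := ae_not_endpoint a; apply: filterS3.
move=> t ta tb H tab; apply: H => //.
move: tab; rewrite in_itv/= => /andP[at' tb'].
by apply: near_in_itvoo; rewrite lt_neqAle ?at' ?tb' ?andbT// eq_sym.
Qed.

Lemma ae_deriv_eql p q a b (X Y Z : R -> 'M[R]_(p, q)) :
  (forall t, t \in `[a, b] -> X t = Z t) ->
  ae_deriv a b X Y -> ae_deriv a b Z Y.
Proof.
move=> XZ [XAC dX]; split.
  by move=> i j; apply: abs_continuous_eq (XAC i j) => t /XZ ->.
apply: ae_interior; apply: filterS dX => t dX tab nt.
apply: mx_is_derive_near (dX tab).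
by apply: filterS nt => u /XZ.
Qed.

Lemma ae_derivM p q r a b (X X' : R -> 'M[R]_(p, q)) (Z Z' : R -> 'M[R]_(q, r)) :
  ae_deriv a b X X' -> ae_deriv a b Z Z' ->
  ae_deriv a b (fun t => X t *m Z t) (fun t => X' t *m Z t + X t *m Z' t).
Proof.
move=> [XAC dX] [ZAC dZ]; split.
  move=> i j; have -> : (fun t => (X t *m Z t) i j) = (fun u => \sum_k X u i k * Z u k j).
    by apply/funext => u; rewrite mxE.
  by apply: abs_continuous_sum => k; exact: abs_continuousM.
by apply: filterS2 dX dZ => t dX dZ tab; apply: mx_is_deriveM; [exact: dX|exact: dZ].
Qed.

Lemma ae_derivD p q a b (X X' Z Z' : R -> 'M[R]_(p, q)) :
  ae_deriv a b X X' -> ae_deriv a b Z Z' ->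
  ae_deriv a b (fun t => X t + Z t) (fun t => X' t + Z' t).
Proof.
move=> [XAC dX] [ZAC dZ]; split.
  move=> i j; under [X in abs_continuous _ _ X]funext do rewrite mxE.
  exact: abs_continuousD (XAC i j) (ZAC i j).
apply: filterS2 dX dZ => t dX dZ tab i j; rewrite mxE.
under [X in is_derive _ _ X]funext do rewrite mxE.
exact: (is_deriveD (dX tab i j) (dZ tab i j)).
Qed.

Lemma ae_derivN p q a b (X X' : R -> 'M[R]_(p, q)) :
  ae_deriv a b X X' -> ae_deriv a b (fun t => - X t) (fun t => - X' t).
Proof.
move=> [XAC dX]; split.
  move=> i j; under [X in abs_continuous _ _ X]funext do rewrite mxE.
  exact: abs_continuousN (XAC i j).
apply: filterS dX => t dX tab i j; rewrite mxE.
under [X in is_derive _ _ X]funext do rewrite mxE.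
exact: (is_deriveN (dX tab i j)).
Qed.

Lemma ae_deriv_tr p q a b (X X' : R -> 'M[R]_(p, q)) :
  ae_deriv a b X X' -> ae_deriv a b (fun t => (X t)^T) (fun t => (X' t)^T).
Proof.
move=> [XAC dX]; split.
  move=> i j; under [X in abs_continuous _ _ X]funext do rewrite mxE.
  exact: XAC.
apply: filterS dX => t dX tab i j; rewrite mxE.
under [X in is_derive _ _ X]funext do rewrite mxE.
exact: (dX tab j i).
Qed.

Lemma ae_deriv_cst p q a b (A : 'M[R]_(p, q)) :
  ae_deriv a b (fun=> A) (fun=> 0).
Proof.
split=> [i j|]; first exact: abs_continuous_cst.
by apply: nearW => t tab i j; rewrite mxE; exact: is_derive_cst.
Qed.

Lemma ae_deriv_zero_cst p q a b (X : R -> 'M[R]_(p, q)) :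
  ae_deriv a b X (fun=> 0) -> forall t, t \in `[a, b] -> X t = X a.
Proof.
move=> [XAC dX] t /[!in_itv]/= /andP[at' tb]; apply/matrixP => i j.
have sub x : x \in `[a, t] -> x \in `[a, b].
  by rewrite !in_itv/= => /andP[-> /le_trans ->].
have dX0 : {ae leb, forall x, x \in `[a, t] -> is_derive x 1 (fun u => X u i j) 0}.
  by apply: filterS dX => x dXx /sub/dXx => /(_ i j); rewrite mxE.
have XtAC : abs_continuous a t (fun u => X u i j) by exact: abs_continuousS (XAC i j).
apply/eqP; rewrite eq_le; apply/andP; split.
  apply: (abs_continuous_nonincreasing at' XtAC).
  by apply: filterS dX0 => x dx /dx; exists 0.
rewrite -lerN2; apply: (abs_continuous_nonincreasing at' (abs_continuousN XtAC)).
apply: filterS dX0 => x dXx /dXx dx; exists (- 0); last by rewrite oppr0.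
exact: (is_deriveN dx).
Qed.

(** Cramer's formula shows that the inverse is absolutely continuous and
differentiable wherever [X] is; its derivative is then forced by the product rule
applied to [X X^-1 = 1]. *)
Lemma ae_deriv_invmx p a b (X Y : R -> 'M[R]_p) :
  (forall t, t \in `[a, b] -> X t \in unitmx) -> ae_deriv a b X Y ->
  ae_deriv a b (fun t => invmx (X t)) (fun t => - (invmx (X t) *m Y t *m invmx (X t))).
Proof.
move=> uX [XAC dX]; split.
  move=> i j.
  apply: (@abs_continuous_eq _ _ (fun t => (\det (X t))^-1 * cofactor (X t) j i)).
    by move=> t tab; rewrite invmx_entryE// uX.
  apply: abs_continuousM.
    apply: abs_continuousV; last exact: abs_continuous_det.
    by move=> t /uX; rewrite unitmxE unitfE.
  apply: abs_continuousM; first exact: abs_continuous_cst.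
  apply: abs_continuous_det => k l.
  by under [X in abs_continuous _ _ X]funext do rewrite !mxE; exact: XAC.
apply: ae_interior; apply: filterS dX => t dX tab nt.
have dXt : mx_is_derive t X (Y t) by exact: dX.
have derX i j : derivable (fun u => X u i j) t 1 by have [] := dXt i j.
have derV i j : derivable (fun u => invmx (X u) i j) t 1.
  apply: (@near_eq_derivable _ _ _ (fun t => (\det (X t))^-1 * cofactor (X t) j i)).
    by near=> u; rewrite invmx_entryE// uX//; near: u.
  apply: derivableM.
    apply: derivableV; last exact: derivable_det.
    by have := uX _ tab; rewrite unitmxE unitfE.
  apply: derivableM; first exact: derivable_cst.
  apply: derivable_det => k l.
  by under [X in derivable X]funext do rewrite !mxE; exact: derX.
pose D : 'M[R]_p := \matrix_(i, j) 'D_1 (fun u => invmx (X u) i j) t.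
have dV : mx_is_derive t (fun u => invmx (X u)) D.
  by move=> i j; rewrite mxE; exact: derivableP.
suff <- : D = - (invmx (X t) *m Y t *m invmx (X t)) by [].
have E : Y t *m invmx (X t) + X t *m D = 0.
  apply: (mx_is_derive_unique (mx_is_deriveM dXt dV)) => i j.
  apply: (@near_eq_is_derive _ _ _ (fun=> (1%:M : 'M[R]_p) i j)); last first.
    by rewrite [X in is_derive _ _ _ X]mxE; exact: is_derive_cst.
  by near=> u; rewrite mulmxV// uX//; near: u.
have := congr1 (mulmx (invmx (X t))) E.
rewrite mulmx0 mulmxDr !mulmxA mulVmx ?uX// mul1mx => /eqP.
by rewrite addrC addr_eq0 => /eqP.
Unshelve. all: by end_near. Qed.

End MatrixCalculus.

(** * Integrable functions, matrix integrals, linear equations *)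

Section IntegrableFunctions.
Variable R : realType.
Local Notation leb := (@lebesgue_measure R).
Local Notation L1 a b f := (leb.-integrable `[a, b] (EFin \o f)).
Implicit Types (a b c M : R) (f g h : R -> R).

Lemma integrable_measurable a b f : L1 a b f -> measurable_fun `[a, b] f.
Proof. by move=> /measurable_int/measurable_EFinP. Qed.

Lemma integrable_ae_le a b f g : measurable_fun `[a, b] f -> L1 a b g ->
  {ae leb, forall t, t \in `[a, b] -> `|f t| <= g t} -> L1 a b f.
Proof.
move=> mf ig fg; have mg := integrable_measurable ig.
apply/integrableP; split; first exact/measurable_EFinP.
have /integrableP[_ goo] := ig.
apply: le_lt_trans goo; apply: ae_ge0_le_integral => //.
- by apply/measurable_EFinP; exact: measurableT_comp.
- by apply/measurable_EFinP; exact: measurableT_comp.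
apply: filterS fg => t fg tab.
by rewrite lee_fin (le_trans (fg tab))// ler_norm.
Qed.

Lemma integrable_cst_itv a b c : L1 a b (fun=> c).
Proof.
have ab_fin : (leb `[a, b] < +oo)%E.
  by rewrite lebesgue_measure_itv/=; case: ifP => // _; rewrite -EFinD ltry.
apply: measurable_bounded_integrable => //.
by exists `|c|; split=> // M cM x _; rewrite /= ltW.
Qed.

Lemma integrable_addf a b f g : L1 a b f -> L1 a b g ->
  L1 a b (fun t => f t + g t).
Proof. by move=> fi gi; apply: integrableD (fi) (gi). Qed.

Lemma integrable_oppf a b f : L1 a b f -> L1 a b (fun t => - f t).
Proof. by move=> fi; apply: integrableN (fi). Qed.

Lemma integrable_scalef a b c f : L1 a b f -> L1 a b (fun t => c * f t).
Proof. by move=> fi; apply: integrableZl (fi). Qed.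

Lemma integrable_sumf a b (I : Type) (s : seq I) (P : pred I) (F : I -> R -> R) :
  (forall i, P i -> L1 a b (F i)) -> L1 a b (fun t => \sum_(i <- s | P i) F i t).
Proof.
move=> iF.
rewrite (_ : EFin \o _ = fun t => (\sum_(i <- s | P i) (F i t)%:E)%E).
  by apply: (@integrable_sum _ _ _ leb _ _ _ _ _ (fun i t => (F i t)%:E)).
by apply/funext => t; rewrite /= sumEFin.
Qed.

Lemma Rintegral_sumf a b (I : Type) (s : seq I) (P : pred I) (F : I -> R -> R) :
  (forall i, P i -> L1 a b (F i)) ->
  \int[leb]_(t in `[a, b]) (\sum_(i <- s | P i) F i t) =
  \sum_(i <- s | P i) \int[leb]_(t in `[a, b]) F i t.
Proof.
move=> iF; elim: s => [|i s IH].
  under eq_Rintegral do rewrite big_nil.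
  by rewrite big_nil Rintegral_cst// mul0r.
under eq_Rintegral do rewrite big_cons.
rewrite big_cons -IH; case: ifPn => // Pi.
by apply: RintegralD => //; [exact: iF|exact: integrable_sumf].
Qed.

Lemma integrable_mul_bounded a b f h M : L1 a b f -> measurable_fun `[a, b] h ->
  {ae leb, forall t, t \in `[a, b] -> `|h t| <= M} -> L1 a b (fun t => f t * h t).
Proof.
move=> fi mh hM; have mf := integrable_measurable fi.
apply: (@integrable_ae_le _ _ _ (fun t => M * `|f t|)).
- exact: measurable_funM.
- exact: integrable_scalef (integrable_norm fi).
by apply: filterS hM => t hM /hM ?; rewrite normrM mulrC ler_wpM2r.
Qed.

Lemma integrable_mulC_AC a b f h : L1 a b f -> abs_continuous a b h ->
  L1 a b (fun t => f t * h t).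
Proof.
move=> fi hAC; have [M _ HM] := abs_continuous_bounded hAC.
apply: (integrable_mul_bounded (M := M)) fi (abs_continuous_measurable hAC) _.
exact: nearW.
Qed.

(** [|f g| <= f^2 + g^2]. *)
Lemma integrable_mul_L2 a b f g :
  measurable_fun `[a, b] f -> L1 a b (fun t => f t ^+ 2) ->
  measurable_fun `[a, b] g -> L1 a b (fun t => g t ^+ 2) ->
  L1 a b (fun t => f t * g t).
Proof.
move=> mf f2 mg g2; apply: (integrable_ae_le _ (integrable_addf f2 g2)).
  exact: measurable_funM.
apply: nearW => t _; rewrite normrM -[f t ^+ 2]real_normK ?num_real//.
rewrite -[g t ^+ 2]real_normK ?num_real//.
by have := normr_ge0 (f t); have := normr_ge0 (g t); nra.
Qed.

End IntegrableFunctions.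

Section MatrixIntegrals.
Variable R : realType.
Local Notation leb := (@lebesgue_measure R).
Local Notation L1 a b f := (leb.-integrable `[a, b] (EFin \o f)).
Implicit Types (a b c : R).

(** The part of [ae_deriv] that does not mention the derivative. *)
Definition ACmx p q a b (X : R -> 'M[R]_(p, q)) : Prop :=
  forall i j, abs_continuous a b (fun t => X t i j).

Lemma L1mx_sub p q a b c d (X : R -> 'M[R]_(p, q)) : a <= c -> d <= b ->
  L1mx a b X -> L1mx c d X.
Proof. by move=> ac db iX i j; exact: integrable_subitv (iX i j). Qed.

(** [|x| <= 1 + x^2], and the segment has finite measure. *)
Lemma L2mx_L1mx p q a b (X : R -> 'M[R]_(p, q)) : L2mx a b X -> L1mx a b X.
Proof.
move=> X2 i j; have [mX iX] := X2 i j.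
apply: (integrable_ae_le mX (integrable_addf (integrable_cst_itv a b 1) iX)).
apply: nearW => t _; rewrite -[X t i j ^+ 2]real_normK ?num_real//.
by have := normr_ge0 (X t i j); nra.
Qed.

Lemma L1mx_eq p q a b (X Y : R -> 'M[R]_(p, q)) :
  (forall t, t \in `[a, b] -> X t = Y t) -> L1mx a b X -> L1mx a b Y.
Proof.
move=> XY iX i j; apply: eq_integrable (iX i j) => // t; rewrite inE/= => tab.
by rewrite XY.
Qed.

Lemma L1mxD p q a b (X Y : R -> 'M[R]_(p, q)) : L1mx a b X -> L1mx a b Y ->
  L1mx a b (fun t => X t + Y t).
Proof.
move=> iX iY i j; have := integrable_addf (iX i j) (iY i j).
by apply: eq_integrable => // t _; rewrite /= mxE.
Qed.

Lemma L1mxN p q a b (X : R -> 'M[R]_(p, q)) : L1mx a b X ->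
  L1mx a b (fun t => - X t).
Proof.
move=> iX i j; have := integrable_oppf (iX i j).
by apply: eq_integrable => // t _; rewrite /= mxE.
Qed.

Lemma L1mx_tr p q a b (X : R -> 'M[R]_(p, q)) : L1mx a b X ->
  L1mx a b (fun t => (X t)^T).
Proof.
move=> iX i j; have := iX j i.
by apply: eq_integrable => // t _; rewrite /= mxE.
Qed.

Lemma L1mx_mulr p q r a b (X : R -> 'M[R]_(p, q)) (Y : R -> 'M[R]_(q, r)) :
  L1mx a b X -> ACmx a b Y -> L1mx a b (fun t => X t *m Y t).
Proof.
move=> iX cY i j.
have : L1 a b (fun t => \sum_k X t i k * Y t k j).
  by apply: integrable_sumf => k _; exact: (integrable_mulC_AC (iX i k) (cY k j)).
by apply: eq_integrable => // t _; rewrite /= mxE.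
Qed.

Lemma L1mx_mull p q r a b (X : R -> 'M[R]_(p, q)) (Y : R -> 'M[R]_(q, r)) :
  ACmx a b X -> L1mx a b Y -> L1mx a b (fun t => X t *m Y t).
Proof.
move=> cX iY; have cXT : ACmx a b (fun t => (X t)^T).
  by move=> i j; under [X in abs_continuous _ _ X]funext do rewrite mxE; exact: cX.
have := L1mx_tr (L1mx_mulr (L1mx_tr iY) cXT).
by apply: L1mx_eq => t _; rewrite trmx_mul !trmxK.
Qed.

Lemma ACmx_cst p q a b (A : 'M[R]_(p, q)) : ACmx a b (fun=> A).
Proof. by move=> i j; exact: abs_continuous_cst. Qed.

Lemma integral_mx_eq p q a b (X Y : R -> 'M[R]_(p, q)) :
  (forall t, t \in `[a, b] -> X t = Y t) -> integral_mx a b X = integral_mx a b Y.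
Proof.
move=> XY; apply/matrixP => i j; rewrite !mxE; apply: eq_Rintegral => t.
by rewrite inE/= => /XY ->.
Qed.

Lemma integral_mxD p q a b (X Y : R -> 'M[R]_(p, q)) : L1mx a b X -> L1mx a b Y ->
  integral_mx a b (fun t => X t + Y t) = integral_mx a b X + integral_mx a b Y.
Proof.
move=> iX iY; apply/matrixP => i j; rewrite !mxE; under eq_Rintegral do rewrite mxE.
by apply: RintegralD => //; [exact: iX|exact: iY].
Qed.

Lemma integral_mxM p q r a b (A : 'M[R]_(p, q)) (X : R -> 'M[R]_(q, r)) :
  L1mx a b X -> integral_mx a b (fun t => A *m X t) = A *m integral_mx a b X.
Proof.
move=> iX; apply/matrixP => i j; rewrite !mxE.
under eq_Rintegral do rewrite mxE.
rewrite Rintegral_sumf => [|k _].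
  apply: eq_bigr => k _; rewrite mxE RintegralZl//; exact: iX.
have := integrable_mulC_AC (iX k j) (abs_continuous_cst a b (A i k)).
by apply: eq_integrable => // t _; rewrite /= mulrC.
Qed.

Lemma integral_mx_tr p q a b (X : R -> 'M[R]_(p, q)) :
  integral_mx a b (fun t => (X t)^T) = (integral_mx a b X)^T.
Proof.
by apply/matrixP => i j; rewrite !mxE; under eq_Rintegral do rewrite mxE.
Qed.

Lemma integral_mxMr p q r a b (B : 'M[R]_(q, r)) (X : R -> 'M[R]_(p, q)) :
  L1mx a b X -> integral_mx a b (fun t => X t *m B) = integral_mx a b X *m B.
Proof.
move=> iX; apply: trmx_inj; rewrite trmx_mul -!integral_mx_tr.
rewrite -integral_mxM; last exact: L1mx_tr.
by apply: integral_mx_eq => t _; rewrite trmx_mul.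
Qed.

Lemma integral_mx_split p q a b c (X : R -> 'M[R]_(p, q)) : a <= c -> c <= b ->
  L1mx a b X -> integral_mx a b X = integral_mx a c X + integral_mx c b X.
Proof.
move=> ac cb iX; apply/matrixP => i j; rewrite !mxE.
by apply: Rintegral_itv_split => //; exact: iX.
Qed.

Lemma integral_mx_set1 p q a (X : R -> 'M[R]_(p, q)) : integral_mx a a X = 0.
Proof. by apply/matrixP => i j; rewrite !mxE set_itv1 Rintegral_set1. Qed.

Lemma ae_forall_mx p q (P : R -> 'I_p -> 'I_q -> Prop) :
  (forall i j, {ae leb, forall t, P t i j}) ->
  {ae leb, forall t, forall i j, P t i j}.
Proof.
move=> H; have : \forall t \ae leb, forall i, forall j, P t i j.
  by apply: filter_forall => i; apply: filter_forall => j; exact: H.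
by [].
Qed.

Lemma ae_deriv_integral p q a b (Y : R -> 'M[R]_(p, q)) : L1mx a b Y ->
  ae_deriv a b (fun t => integral_mx a t Y) Y.
Proof.
move=> iY; split=> [i j|].
  under [X in abs_continuous _ _ X]funext do rewrite mxE.
  exact: abs_continuous_primitive (iY i j).
have : \forall t \ae leb, forall i j, t \in `[a, b] ->
    is_derive t 1 (fun u => integral_mx a u Y i j) (Y t i j).
  apply: ae_forall_mx => i j.
  have := is_derive_primitive (iY i j); apply: filterS => t H tab.
  under [X in is_derive _ _ X]funext do rewrite mxE.
  exact: H.
by apply: filterS => t H tab i j; exact: H.
Qed.

Lemma ae_deriv_unique p q a b c (X Y Z : R -> 'M[R]_(p, q)) :
  ae_deriv a b X Z -> ae_deriv a b Y Z -> c \in `[a, b] -> X c = Y c ->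
  forall t, t \in `[a, b] -> X t = Y t.
Proof.
move=> dX dY cab XYc t tab; apply/eqP; rewrite -subr_eq0; apply/eqP.
have dXY : ae_deriv a b (fun t => X t - Y t) (fun=> 0).
  apply: ae_deriv_eqr (ae_derivD dX (ae_derivN dY)).
  by apply: nearW => u _; rewrite subrr.
by rewrite (ae_deriv_zero_cst dXY tab) -(ae_deriv_zero_cst dXY cab) XYc subrr.
Qed.

(** Gronwall's lemma for the sum of the squares of the entries of [X]: the
derivative of [X_ij^2] is bounded by [sum_l 2 |A_il| |X_ij| |X_lj|], and each
[|X_ij| |X_lj|] by the sum of all squares. *)
Lemma linear_ode_unique p q a b c (A : R -> 'M[R]_p) (X : R -> 'M[R]_(p, q)) :
  c \in `[a, b] -> L1mx a b A -> ae_deriv a b X (fun t => A t *m X t) -> X c = 0 ->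
  forall t, t \in `[a, b] -> X t = 0.
Proof.
move=> cab iA [cX dX] Xc t tab.
pose f u := \sum_i \sum_j (X u i j * X u i j).
(* the Gronwall coefficient: an integrable bound for the derivative of [f] over [f] *)
pose k u := \sum_i \sum_(j < q) \sum_l 2 * `|A u i l|.
have f_ge i j u : `|X u i j| ^+ 2 <= f u.
  rewrite /f (bigD1 i)//= (bigD1 j)//= -addrA real_normK ?num_real// expr2 lerDl.
  rewrite addr_ge0 ?sumr_ge0// => [? _|? _]; rewrite ?sumr_ge0// => *.
    by rewrite -expr2 sqr_ge0.
  by rewrite -expr2 sqr_ge0.
have fp u : 0 <= f u by rewrite !sumr_ge0// => *; rewrite sumr_ge0// => *; rewrite -expr2 sqr_ge0.
suff f0 : f t = 0.
  apply/matrixP => i j; rewrite mxE; have := f_ge i j t; rewrite f0.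
  by rewrite real_normK ?num_real// le_eqVlt ltNge sqr_ge0 orbF sqrf_eq0 => /eqP.
apply: (@gronwall_zero _ a b c f k) => //.
- apply: abs_continuous_sum => i; apply: abs_continuous_sum => j.
  exact: abs_continuousM.
- by rewrite /f big1// => i _; rewrite big1// => j _; rewrite Xc mxE mul0r.
- apply: integrable_sumf => i _; apply: integrable_sumf => j _.
  apply: integrable_sumf => l _.
  exact: integrable_scalef (integrable_norm (iA i l)).
apply: filterS dX => u dX uab.
exists (\sum_i \sum_j (X u i j * (A u *m X u) i j + X u i j * (A u *m X u) i j)).
  apply: is_derive_sum_fun => i; apply: is_derive_sum_fun => j.
  exact: (is_deriveM (dX uab i j) (dX uab i j)).
rewrite mulr_suml; apply: le_trans (ler_norm_sum _ _ _) _; apply: ler_sum => i _.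
rewrite mulr_suml; apply: le_trans (ler_norm_sum _ _ _) _; apply: ler_sum => j _.
rewrite -mulr2n -[X in `|X|]mulr_natl normrM normr_nat mxE mulr_sumr mulr_suml.
apply: le_trans (ler_wpM2l _ (ler_norm_sum _ _ _)) _ => //.
rewrite mulr_sumr; apply: ler_sum => l _; rewrite !normrM.
have := f_ge i j u; have := f_ge l j u; have := normr_ge0 (A u i l).
have := sqr_ge0 (`|X u i j| - `|X u l j|).
move: `|A u i l| `|X u i j| `|X u l j| => x y z.
rewrite sqrrB mulr2n => s x0 zf yf.
have yz : y * z <= f u by nra.
have -> : 2 * (y * (x * z)) = 2 * x * (y * z) by ring.
by rewrite ler_wpM2l// mulr_ge0.
Qed.

End MatrixIntegrals.

(** * Kernels are determined almost everywhere; transition matrices *)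

Section KernelUniqueness.
Variable R : realType.
Local Notation leb := (@lebesgue_measure R).
Implicit Types (a b : R).

Lemma L2mx_indic_delta p a b (E : set R) (j : 'I_p) : measurable E ->
  L2mx a b (fun t => \1_E t *: delta_mx j 0 : 'cV[R]_p).
Proof.
move=> mE i k.
have mf : measurable_fun `[a, b] (fun t => (\1_E t *: delta_mx j 0 : 'cV[R]_p) i k).
  under [X in measurable_fun _ X]funext do rewrite !mxE.
  by apply: measurable_funM => //; exact: measurable_indic.
split=> //; apply: (integrable_ae_le _ (integrable_cst_itv a b 1)).
  by apply: measurable_funX.
apply: nearW => t _; rewrite normrX !mxE normrM indicE.
by case: (_ \in _); case: (_ && _); rewrite ?normr0 ?normr1 ?mulr0 ?mul0r
  ?mul1r ?expr0n ?expr1n//= ler01.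
Qed.

(** Testing against the indicator of [E] times the [j]-th basis vector gives the
integrals over [E] of the [j]-th columns. *)
Lemma kernel_ae_unique p a b (k k0 : R -> 'M[R]_p) :
  (forall l : R -> 'cV[R]_p, L2mx a b l ->
    [/\ L1mx a b (fun t => k t *m l t), L1mx a b (fun t => k0 t *m l t) &
      integral_mx a b (fun t => k t *m l t) = integral_mx a b (fun t => k0 t *m l t)]) ->
  {ae leb, forall t, t \in `[a, b] -> k t = k0 t}.
Proof.
move=> H.
have ent (A : 'M[R]_p) c i j : (A *m (c *: delta_mx j 0 : 'cV[R]_p)) i 0 = A i j * c.
  by rewrite -scalemxAr -colE !mxE mulrC.
have int_ent (h : R -> 'M[R]_p) i j : (forall l : R -> 'cV[R]_p, L2mx a b l ->
    L1mx a b (fun t => h t *m l t)) -> leb.-integrable `[a, b] (EFin \o (fun t => h t i j)).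
  move=> Hh; have := Hh _ (L2mx_indic_delta a b j measurableT) i 0.
  by apply: eq_integrable => // t _; rewrite /= ent indicT mulr1.
suff : \forall t \ae leb, forall i j, t \in `[a, b] -> k t i j = k0 t i j.
  by apply: filterS => t E tab; apply/matrixP => i j; exact: E.
apply: ae_forall_mx => i j.
have ik : leb.-integrable `[a, b] (EFin \o (fun t => k t i j)).
  by apply: int_ent => l /H[].
have ik0 : leb.-integrable `[a, b] (EFin \o (fun t => k0 t i j)).
  by apply: int_ent => l /H[].
have : ae_eq leb [set` `[a, b]] (EFin \o (fun t => k t i j)) (EFin \o (fun t => k0 t i j)).
  apply: integral_ae_eq => //; first exact: measurable_int ik0.
  move=> E Eab mE; have [_ _] := H _ (L2mx_indic_delta a b j mE).
  move=> /matrixP/(_ i 0); rewrite !mxE.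
  have int_E (h : R -> 'M[R]_p) : leb.-integrable `[a, b] (EFin \o (fun t => h t i j)) ->
      ((\int[leb]_(t in `[a, b]) ((h t *m (\1_E t *: delta_mx j 0 : 'cV[R]_p)) i 0))%:E =
      \int[leb]_(t in E) (h t i j)%:E)%E.
    move=> ih.
    have -> : \int[leb]_(t in `[a, b]) ((h t *m (\1_E t *: delta_mx j 0 : 'cV[R]_p)) i 0) =
       \int[leb]_(t in E) (h t i j).
      rewrite -[in RHS](setIidr Eab).
      rewrite Rintegral_mkcondr; apply: eq_Rintegral => t _.
      by rewrite ent patchE indicE; case: ifPn => _; rewrite ?mulr1 ?mulr0.
    rewrite /Rintegral fineK//; apply: integrable_fin_num => //.
    exact: integrableS ih.
  by move=> E12; rewrite -!int_E// E12.
by apply: filterS => t E tab; have [] := E tab.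
Qed.

End KernelUniqueness.

Section TransitionMatrix.
Variable R : realType.
Implicit Types (a b t s : R).

(** By uniqueness for the linear equation, [Phi s t *m Phi t a = Phi s a]; taking
[s = a] shows that [Phi t a] is invertible. *)
Lemma transition_mx_factor p a b (A : R -> 'M[R]_p) Phi : a <= b ->
  L1mx a b A -> transition_mx a b A Phi -> forall t, t \in `[a, b] ->
  Phi t a \in unitmx /\
  (forall s, s \in `[a, b] -> Phi s t = Phi s a *m invmx (Phi t a)).
Proof.
move=> ab iA HPhi t tab.
have aab : a \in `[a, b] by rewrite in_itv/= lexx.
have [dX Xa] := HPhi _ aab; have [dPt Ptt] := HPhi _ tab.
have cocycle s : s \in `[a, b] -> Phi s t *m Phi t a = Phi s a.
  move=> sab; apply/eqP; rewrite -subr_eq0; apply/eqP.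
  apply: (linear_ode_unique (X := fun s => Phi s t *m Phi t a - Phi s a) tab iA) => //.
    have := ae_derivD (ae_derivM dPt (ae_deriv_cst a b (Phi t a))) (ae_derivN dX).
    apply: ae_deriv_eqr; apply: nearW => u _.
    by rewrite mulmx0 addr0 mulmxBr mulmxA.
  by rewrite Ptt mul1mx subrr.
have uX : Phi t a \in unitmx.
  by have := cocycle _ aab; rewrite Xa => /mulmx1_unit[].
by split=> // s /cocycle <-; rewrite mulmxK.
Qed.

End TransitionMatrix.

(** * The state kernel *)

Section MatrixAlgebra.
Variable R : realType.

Lemma sqnorm_le0_eq0 p (x : 'cV[R]_p) : (x^T *m x) 0 0 <= 0 -> x = 0.
Proof.
rewrite mxE => x0; apply/matrixP => i j; rewrite ord1 mxE.
have E k : 0 <= x^T 0 k * x k 0 by rewrite mxE -expr2 sqr_ge0.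
have /eqP : \sum_k x^T 0 k * x k 0 = 0 by apply/eqP; rewrite eq_le x0 sumr_ge0.
rewrite psumr_eq0// => /allP/(_ i); rewrite mem_index_enum => /(_ isT).
by rewrite mxE -expr2 sqrf_eq0 => /eqP.
Qed.

Lemma unitmx_ker0 p (A : 'M[R]_p) : (forall x : 'cV[R]_p, A *m x = 0 -> x = 0) ->
  A \in unitmx.
Proof.
move=> H; rewrite -unitmx_tr -row_free_unit -kermx_eq0; apply/rowV0P => v.
move=> /sub_kermxP vA; apply: trmx_inj; rewrite trmx0; apply: H.
by apply: trmx_inj; rewrite trmx_mul trmxK vA trmx0.
Qed.

(** If [x + P S P x = 0], pairing with [x] gives [|x|^2 + <S P x, P x> = 0]. *)
Lemma sandwich_unitmx p (P S : 'M[R]_p) : psd P -> psd S ->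
  1%:M + P *m S *m P \in unitmx.
Proof.
move=> [PT _] [_ Spos]; apply: unitmx_ker0 => x Hx; apply: sqnorm_le0_eq0.
have := congr1 (mulmx x^T) Hx; rewrite mulmx0 mulmxDl mulmxDr mul1mx.
move=> /matrixP/(_ 0 0); rewrite mxE [RHS]mxE => E.
have := Spos (P *m x); rewrite trmx_mul PT !mulmxA => S0.
move: E; rewrite !mulmxA => E.
by lra.
Qed.

(** With [x = P (y - S z)] the left-hand equation says [z = P x], and substituting
this in the definition of [x] gives [(1 + P S P) x = P y]. *)
Lemma sandwich_solve p (P S : 'M[R]_p) (y : 'cV[R]_p) :
  1%:M + P *m S *m P \in unitmx -> forall z,
  z = P *m P *m (y - S *m z) <-> z = P *m invmx (1%:M + P *m S *m P) *m P *m y.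
Proof.
move=> uM z; set M := 1%:M + _ in uM *; split=> [Ez|Ez].
  pose x := P *m (y - S *m z).
  have zx : z = P *m x by rewrite [LHS]Ez /x mulmxA.
  have Mx : M *m x = P *m y.
    rewrite mulmxDl mul1mx -[P *m S *m P *m x]mulmxA -zx /x mulmxBr.
    by rewrite mulmxA subrK.
  by rewrite zx -!mulmxA -Mx mulKmx.
pose x := invmx M *m P *m y; have Mx : M *m x = P *m y by rewrite /x -mulmxA mulKVmx.
have zx : z = P *m x by rewrite Ez /x !mulmxA.
rewrite [LHS]zx -mulmxA; congr (_ *m _).
by rewrite mulmxBr -Mx mulmxDl mul1mx zx !mulmxA addrK.
Qed.

(** The left-hand side is the derivative of [nu - Sg mu] along the system, with the
derivative of [Sg] given by the Riccati equation. *)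
Lemma riccati_decoupling p (F S N Sg : 'M[R]_p) (mu nu l : 'cV[R]_p) :
  S^T = S -> Sg^T = Sg ->
  - (F^T *m nu + N *m mu - l)
    - (- (Sg *m F + F^T *m Sg - Sg *m S *m Sg + N) *m mu + Sg *m (F *m mu - S *m nu))
  = - ((F - S *m Sg)^T *m (nu - Sg *m mu)) + l.
Proof.
move=> ST SgT.
have -> : (F - S *m Sg)^T = F^T - Sg *m S by rewrite linearB/= trmx_mul ST SgT.
rewrite !(mulmxBl, mulmxBr, mulmxDl, mulmxDr, mulNmx, mulmxN) !mulmxA.
move: (F^T *m nu) (N *m mu) (Sg *m F *m mu) (F^T *m Sg *m mu) => a b c d.
move: (Sg *m S *m Sg *m mu) (Sg *m S *m nu) => e f.
by apply/matrixP => i j; rewrite !mxE; ring.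
Qed.

End MatrixAlgebra.

Section HamiltonianSystem.
Variables (R : realType) (n : nat) (t0 T : R).
Variables (F S N : R -> 'M[R]_n) (Pi0 SigmaT : 'M[R]_n).
Local Notation leb := (@lebesgue_measure R).

(** The boundary value problem for arbitrary [S] and [N] in place of GQG^* and
H^*R^-1H, a form that is stable under time reversal. *)
Definition hamiltonian_bvp (lmu lnu mu nu : R -> 'cV[R]_n) : Prop :=
  [/\ ae_deriv t0 T mu (fun t => F t *m mu t - S t *m nu t + lmu t),
      ae_deriv t0 T nu (fun t => - ((F t)^T *m nu t + N t *m mu t - lnu t)),
      mu t0 = - (Pi0 *m nu t0) & nu T = SigmaT *m mu T].

(** The defining property of K for arbitrary [S] and [N]. *)
Definition state_kernel (K : R -> R -> 'M[R]_n) : Prop :=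
  forall s, s \in `[t0, T] -> forall lnu, L2mx t0 T lnu ->
  [/\ L1mx t0 T (fun t => K s t *m lnu t),
      exists mu nu, hamiltonian_bvp (fun=> 0) lnu mu nu &
      forall mu nu, hamiltonian_bvp (fun=> 0) lnu mu nu ->
        mu s = integral_mx t0 T (fun t => K s t *m lnu t)].

Variables (P : 'M[R]_n) (Sigma : R -> 'M[R]_n) (Phi : R -> R -> 'M[R]_n).

Hypothesis t0T : t0 < T.
Hypotheses (F_L1 : L1mx t0 T F) (S_L1 : L1mx t0 T S).
Hypothesis S_sym : {ae leb, forall t, t \in `[t0, T] -> (S t)^T = S t}.
Hypotheses (P_psd : psd P) (PP : P *m P = Pi0).
Hypothesis Sigma_psd : forall t, t \in `[t0, T] -> psd (Sigma t).
Hypothesis Sigma_eq : ae_deriv t0 T Sigma (fun t =>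
  - (Sigma t *m F t + (F t)^T *m Sigma t - Sigma t *m S t *m Sigma t + N t)).
Hypothesis Sigma_end : Sigma T = SigmaT.
Hypothesis Phi_eq : transition_mx t0 T (fun t => F t - S t *m Sigma t) Phi.

Let A t := F t - S t *m Sigma t.
Let C := P *m invmx (1%:M + P *m Sigma t0 *m P) *m P.
Let X t := Phi t t0.
Let V t := invmx (X t).
(** [W] vanishes at [t0] and satisfies [z' = W' p] for the state in moving
   coordinates [z = X^-1 mu]. *)
Let dW t := V t *m S t *m (V t)^T.
Let W t := integral_mx t0 t dW.

Let t0I : t0 \in `[t0, T]. Proof. by rewrite in_itv/= lexx ltW. Qed.
Let TI : T \in `[t0, T]. Proof. by rewrite in_itv/= lexx ltW. Qed.

Let A_L1 : L1mx t0 T A.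
Proof.
by apply: L1mxD => //; apply/L1mxN/L1mx_mulr => //; case: Sigma_eq.
Qed.

Let X_unit t : t \in `[t0, T] -> X t \in unitmx.
Proof. by move=> tI; have [] := transition_mx_factor (ltW t0T) A_L1 Phi_eq tI. Qed.

Let Phi_factor s t : s \in `[t0, T] -> t \in `[t0, T] -> Phi s t = X s *m V t.
Proof.
by move=> sI tI; have [_] := transition_mx_factor (ltW t0T) A_L1 Phi_eq tI; apply.
Qed.

Let X_eq : ae_deriv t0 T X (fun t => A t *m X t).
Proof. by have [] := Phi_eq t0I. Qed.

Let X_start : X t0 = 1%:M.
Proof. by have [] := Phi_eq t0I. Qed.

Let V_start : V t0 = 1%:M.
Proof. by rewrite /V X_start invmx1. Qed.

Let V_eq : ae_deriv t0 T V (fun t => - (V t *m A t)).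
Proof.
apply: ae_deriv_eqr (ae_deriv_invmx X_unit X_eq); apply: nearW => t tI.
by rewrite mulmxA mulmxK ?X_unit.
Qed.

Let VT_eq := ae_deriv_tr V_eq.

Let dW_L1 : L1mx t0 T dW.
Proof.
apply: L1mx_mulr; last by case: VT_eq.
by apply: L1mx_mull => //; case: V_eq.
Qed.

Let W_eq : ae_deriv t0 T W dW. Proof. exact: ae_deriv_integral. Qed.

Let W_start : W t0 = 0. Proof. exact: integral_mx_set1. Qed.

Let min_integral u v : u \in `[t0, T] -> v \in `[t0, T] ->
  integral_mx t0 (Num.min u v) (fun tau => Phi u tau *m S tau *m (Phi v tau)^T) =
  X u *m W (Num.min u v) *m (X v)^T.
Proof.
move=> uI vI; set c := Num.min u v.
have cT : c <= T by rewrite /c ge_min; move: uI; rewrite in_itv/= => /andP[_ ->].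
have dWc : L1mx t0 c dW by exact: L1mx_sub dW_L1.
rewrite -integral_mxM// -integral_mxMr; last first.
  by apply: L1mx_mull dWc; exact: ACmx_cst.
apply: integral_mx_eq => t; rewrite in_itv/= => /andP[t0t tc].
have tI : t \in `[t0, T] by rewrite in_itv/= t0t (le_trans tc).
by rewrite !Phi_factor// trmx_mul !mulmxA.
Qed.

Section Forcing.
Variable l : R -> 'cV[R]_n.
Hypothesis l_L2 : L2mx t0 T l.

Let l_L1 : L1mx t0 T l := L2mx_L1mx l_L2.
Let g t := (X t)^T *m l t.
(** [p] is the integral of [g] from [t] to [T], and [z] is the solution of
   [z' = W' p] with [z t0 = C p t0], integrated by parts. *)
Let p t := integral_mx t0 T g - integral_mx t0 t g.
Let z t := C *m p t0 + W t *m p t + integral_mx t0 t (fun u => W u *m g u).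

Let g_L1 : L1mx t0 T g.
Proof. by apply: L1mx_mull => //; have [] := ae_deriv_tr X_eq. Qed.

Let Wg_L1 : L1mx t0 T (fun u => W u *m g u).
Proof. by apply: L1mx_mull => //; case: W_eq. Qed.

Let p_eq : ae_deriv t0 T p (fun t => - g t).
Proof.
apply: ae_deriv_eqr (ae_derivD (ae_deriv_cst _ _ _) (ae_derivN (ae_deriv_integral g_L1))).
by apply: nearW => t _; rewrite add0r.
Qed.

Let p_end : p T = 0. Proof. exact: subrr. Qed.

Let z_eq : ae_deriv t0 T z (fun t => dW t *m p t).
Proof.
have := ae_derivD (ae_derivD (ae_deriv_cst t0 T (C *m p t0)) (ae_derivM W_eq p_eq))
  (ae_deriv_integral Wg_L1).
by apply: ae_deriv_eqr; apply: nearW => t _; rewrite add0r mulmxN subrK.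
Qed.

Let z_start : z t0 = C *m p t0.
Proof. by rewrite /z W_start mul0mx !integral_mx_set1 !addr0. Qed.

Let kernel s t := X s *m (C + W (Num.min s t)) *m (X t)^T.

(** Splitting at [s]: on [[t0, s]] the minimum is [t] and on [[s, T]] it is [s],
so the integral is [C p(t0) + (integral of W g over [t0, s]) + W s p s]. *)
Lemma min_kernel_integral s : s \in `[t0, T] ->
  L1mx t0 T (fun t => kernel s t *m l t) /\
  integral_mx t0 T (fun t => kernel s t *m l t) = X s *m z s.
Proof.
move=> sI; move: (sI); rewrite in_itv/= => /andP[t0s sT].
have cW : ACmx t0 T W by case: W_eq.
have kg_L1 : L1mx t0 T (fun t => (C + W (Num.min s t)) *m g t).
  apply: L1mx_mull g_L1 => i j.
  under [X in abs_continuous _ _ X]funext do rewrite mxE.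
  exact: abs_continuousD (abs_continuous_cst _ _ _) (abs_continuous_min t0s (cW i j)).
have kE t : kernel s t *m l t = X s *m ((C + W (Num.min s t)) *m g t).
  by rewrite /kernel /g !mulmxA.
have kl_L1 : L1mx t0 T (fun t => X s *m ((C + W (Num.min s t)) *m g t)).
  by apply: L1mx_mull kg_L1; exact: ACmx_cst.
split; first by apply: L1mx_eq kl_L1 => t _; rewrite kE.
under [X in integral_mx _ _ X]funext do rewrite kE.
rewrite integral_mxM//; congr (_ *m _).
have Cg_L1 : L1mx t0 T (fun t => C *m g t) by apply: L1mx_mull g_L1; exact: ACmx_cst.
have Wming_L1 : L1mx t0 T (fun t => W (Num.min s t) *m g t).
  apply: L1mx_mull g_L1 => i j; exact: abs_continuous_min (cW i j).
under [X in integral_mx _ _ X]funext do rewrite mulmxDl.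
rewrite (integral_mxD Cg_L1 Wming_L1) (integral_mxM C g_L1).
rewrite (integral_mx_split t0s sT Wming_L1).
have -> : integral_mx t0 s (fun t => W (Num.min s t) *m g t) =
    integral_mx t0 s (fun t => W t *m g t).
  by apply: integral_mx_eq => t; rewrite in_itv/= => /andP[_ ts]; rewrite min_r.
have -> : integral_mx s T (fun t => W (Num.min s t) *m g t) = W s *m integral_mx s T g.
  rewrite -integral_mxM; last by exact: L1mx_sub g_L1.
  by apply: integral_mx_eq => t; rewrite in_itv/= => /andP[st _]; rewrite min_l.
rewrite /z /p integral_mx_set1 subr0 (integral_mx_split t0s sT g_L1).
by rewrite [X in _ = _ + _ *m X + _]addrAC subrr add0r -addrA [X in _ + X]addrC.
Qed.

(** [mu = X z] and [nu = w + Sigma mu] with [w = - X^-* p]. *)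
Lemma forced_solution_exists : exists mu nu, hamiltonian_bvp (fun=> 0) l mu nu.
Proof.
pose mu t := X t *m z t; pose w t := - ((V t)^T *m p t).
have A_tr t : t \in `[t0, T] -> (V t)^T *m (X t)^T = 1%:M.
  by move=> tI; rewrite -trmx_mul mulmxV ?X_unit// trmx1.
have w_eq : ae_deriv t0 T w (fun t => - ((A t)^T *m w t) + l t).
  apply: ae_deriv_eqr (ae_derivN (ae_derivM VT_eq p_eq)); apply: nearW => t tI.
  rewrite linearN/= trmx_mul /w /g !mulmxN !mulNmx opprK opprD !opprK !mulmxA.
  by rewrite A_tr// mul1mx.
have mu_eq : ae_deriv t0 T mu (fun t => A t *m mu t - S t *m w t).
  apply: ae_deriv_eqr (ae_derivM X_eq z_eq); apply: nearW => t tI.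
  by rewrite /mu /w /dW mulmxN opprK !mulmxA mulmxV ?X_unit// mul1mx.
have mu_eq' : ae_deriv t0 T mu (fun t => F t *m mu t - S t *m (w t + Sigma t *m mu t) + 0).
  apply: ae_deriv_eqr mu_eq; apply: nearW => t _.
  by rewrite addr0 /A mulmxBl mulmxDr opprD [- (S t *m w t) + _]addrC addrA !mulmxA.
have nu_eq := ae_derivD w_eq (ae_derivM Sigma_eq mu_eq').
exists mu, (fun t => w t + Sigma t *m mu t); split=> //.
- apply: ae_deriv_eqr nu_eq; apply: filterS S_sym => t St_sym tI.
  have := riccati_decoupling (F t) (N t) (mu t) (w t + Sigma t *m mu t) (l t) (St_sym tI)
    (Sigma_psd tI).1.
  by rewrite addrK addr0 => <-; rewrite subrK.
(* the boundary relation at [t0], with [nu t0 = - p t0 + Sigma t0 *m z t0] *)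
- have zE : z t0 = Pi0 *m (p t0 - Sigma t0 *m z t0).
    rewrite -PP; apply/sandwich_solve; last exact: z_start.
    exact: sandwich_unitmx (Sigma_psd t0I).
  have w0 : w t0 = - p t0 by rewrite /w V_start trmx1 mul1mx.
  by rewrite /mu X_start mul1mx [LHS]zE w0 -[RHS]mulmxN opprD opprK.
- by rewrite /w p_end mulmx0 oppr0 add0r Sigma_end.
Qed.

(** For any solution the two quadratures for [X^* w] and [X^-1 mu] are integrated
from their known values, at [T] and then at [t0]. *)
Lemma forced_solution_unique mu nu : hamiltonian_bvp (fun=> 0) l mu nu ->
  forall s, s \in `[t0, T] -> mu s = X s *m z s.
Proof.
move=> [mu_eq nu_eq mu_start nu_end].
pose w t := nu t - Sigma t *m mu t.
have w_eq : ae_deriv t0 T w (fun t => - ((A t)^T *m w t) + l t).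
  apply: ae_deriv_eqr (ae_derivD nu_eq (ae_derivN (ae_derivM Sigma_eq mu_eq))).
  apply: filterS S_sym => t St_sym tI.
  by rewrite addr0 -(riccati_decoupling (F t) (N t)) ?St_sym// (Sigma_psd tI).1.
have w_E t : t \in `[t0, T] -> (X t)^T *m w t = - p t.
  apply: (@ae_deriv_unique _ _ _ _ _ _ (fun t => (X t)^T *m w t) (fun t => - p t) g _ _ TI).
  - apply: ae_deriv_eqr (ae_derivM (ae_deriv_tr X_eq) w_eq); apply: nearW => u _.
    rewrite /g; move: (w u) => y.
    by rewrite trmx_mul mulmxDr mulmxN !mulmxA addrA subrr add0r.
  - apply: ae_deriv_eqr (ae_derivN p_eq); apply: nearW => u _; exact: opprK.
  - by rewrite p_end oppr0 /w nu_end Sigma_end subrr mulmx0.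
have z_E t : t \in `[t0, T] -> V t *m mu t = z t.
  apply: (@ae_deriv_unique _ _ _ _ _ _ (fun t => V t *m mu t) z _ _ z_eq t0I).
    apply: ae_deriv_eqr (ae_derivM V_eq mu_eq); apply: nearW => u uI.
    have <- : - ((X u)^T *m w u) = p u by rewrite w_E// opprK.
    rewrite /dW mulmxN !mulmxA -[V u *m S u *m (V u)^T *m _]mulmxA -trmx_mul.
    rewrite mulmxV ?X_unit// trmx1 mulmx1 addr0 /w /A.
    rewrite !(mulmxBr, mulmxBl, mulNmx, mulmxN) !mulmxA.
    move: (V u *m F u *m mu u) (V u *m S u *m Sigma u *m mu u) (V u *m S u *m nu u).
    by move=> a b c; apply/matrixP => i j; rewrite !mxE; ring.
  rewrite V_start mul1mx z_start; apply/sandwich_solve.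
    exact: sandwich_unitmx (Sigma_psd t0I).
  rewrite PP [LHS]mu_start -mulmxN; congr (_ *m _).
  have := congr1 -%R (w_E _ t0I); rewrite opprK X_start trmx1 mul1mx /w => <-.
  by rewrite opprB addrAC subrr add0r.
by move=> s sI; rewrite -z_E// mulmxA mulmxV ?X_unit// mul1mx.
Qed.

End Forcing.

Theorem state_kernel_formula : is_the_kernel t0 T state_kernel (fun s t =>
  Phi s t0 *m P *m invmx (1%:M + P *m Sigma t0 *m P) *m P *m (Phi t t0)^T +
  integral_mx t0 (Num.min s t) (fun tau => Phi s tau *m S tau *m (Phi t tau)^T)).
Proof.
set K0 := (X in is_the_kernel _ _ _ X).
have K0E s t : s \in `[t0, T] -> t \in `[t0, T] ->
    K0 s t = X s *m (C + W (Num.min s t)) *m (X t)^T.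
  by move=> sI tI; rewrite /K0 min_integral// mulmxDr mulmxDl /C !mulmxA.
have K0_kernel : state_kernel K0.
  move=> s sI l l_L2; have [iK EK] := min_kernel_integral l_L2 sI.
  split.
  - by apply: L1mx_eq iK => t tI; rewrite K0E.
  - exact: forced_solution_exists.
  move=> mu nu /(forced_solution_unique l_L2)/(_ s sI) ->; rewrite -EK.
  by apply: integral_mx_eq => t tI; rewrite K0E.
split=> // K K_kernel s sI; apply: kernel_ae_unique => l l_L2.
have [iK [mu [nu sol]] EK] := K_kernel s sI l l_L2.
have [iK0 _ EK0] := K0_kernel s sI l l_L2.
by split=> //; rewrite -(EK _ _ sol) -(EK0 _ _ sol).
Qed.

End HamiltonianSystem.

(** * Time reversal *)

Section TimeReversal.
Variable R : realType.
Local Notation leb := (@lebesgue_measure R).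
Local Notation L1 a b f := (leb.-integrable `[a, b] (EFin \o f)).
Implicit Types (a b c : R).

Let refl c : measurableTypeR R -> measurableTypeR R := fun t => c - t.

Let measurable_refl c : measurable_fun setT (refl c).
Proof. by apply: (measurable_funB (measurable_cst c) (@measurable_id _ _ _)). Qed.

Let lebesgue_measure_refl c (A : set (measurableTypeR R)) : measurable A ->
  leb (refl c @^-1` A) = leb A.
Proof.
move=> mA; rewrite -[LHS]/(pushforward leb (refl c) A).
apply/esym/lebesgue_measure_unique => //= _ [[a b]] _ <-.
rewrite /pushforward.
have -> : refl c @^-1` `]a, b] = `[c - b, c - a[%classic.
  by apply/seteqP; split=> x; rewrite /refl/= !in_itv/= => /andP[? ?];
    apply/andP; split; lra.
rewrite !lebesgue_measure_itv/= !lte_fin ltrD2l ltrN2.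
by case: ifP => // _; rewrite -!EFinD; congr EFin; ring.
Qed.

Lemma ae_refl c (P : R -> Prop) : {ae leb, forall t, P t} ->
  {ae leb, forall t, P (c - t)}.
Proof.
move=> [N [mN N0 PN]]; exists (refl c @^-1` N); split.
- by rewrite -[X in measurable X]setTI; exact: measurable_refl.
- by rewrite lebesgue_measure_refl.
by move=> t Pt; exact: PN.
Qed.

Lemma in_itv_refl a b t : (a + b - t \in `[a, b]) = (t \in `[a, b]).
Proof.
by rewrite !in_itv/=; apply/andP/andP => -[? ?]; split; lra.
Qed.

Let refl_integral c (h : R -> R) : leb.-integrable setT (EFin \o h) ->
  leb.-integrable setT (EFin \o (fun t => h (c - t))) /\
  (\int[leb]_t (h (c - t))%:E = \int[leb]_t (h t)%:E)%E.
Proof.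
move=> ih; have mh : measurable_fun [set: measurableTypeR R] (EFin \o h).
  exact: measurable_int ih.
have mhr : measurable_fun [set: measurableTypeR R] (EFin \o h \o refl c).
  exact: measurableT_comp (measurable_refl c).
have ihr : leb.-integrable setT (EFin \o (fun t => h (c - t))).
  apply/integrableP; split; first exact: mhr.
  have /integrableP[_] := ih; apply: le_lt_trans.
  have := ge0_integral_pushforward (measurable_refl c) leb measurableT
    (measurableT_comp (@abse_measurable _ setT) mh) (fun x _ => abse_ge0 (h x)%:E).
  rewrite preimage_setT => /= <-; rewrite le_eqVlt; apply/orP; left; apply/eqP.
  by apply: eq_measure_integral => A mA _; exact: lebesgue_measure_refl.
split=> //.
have := @integral_pushforward _ _ _ _ R (refl c) (measurable_refl c) leb setT _ mh.
rewrite preimage_setT => /(_ ihr measurableT) /= <-.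
by apply: eq_measure_integral => A mA _; exact: lebesgue_measure_refl.
Qed.

Let patch_refl a b c (f : R -> R) :
  (fun t => (f \_ `[a, b]) (c - t)) = (fun t => f (c - t)) \_ `[c - b, c - a].
Proof.
apply/funext => t; rewrite !patchE.
have -> : (c - t \in [set` `[a, b]]) = (t \in [set` `[c - b, c - a]]).
  by apply/idP/idP; rewrite !inE/= !in_itv/= => /andP[? ?]; apply/andP; split; lra.
by [].
Qed.

Lemma integrable_refl a b c (f : R -> R) : L1 a b f ->
  L1 (c - b) (c - a) (fun t => f (c - t)).
Proof.
move=> iF.
have : leb.-integrable setT (EFin \o (f \_ `[a, b])).
  rewrite -restrict_EFin.
  by apply: (integrable_mkcond (mu := leb) _ _).1 => //; exact: measurable_itv.
move=> /(refl_integral c)[H _].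
apply: (integrable_mkcond (mu := leb) _ _).2; first exact: measurable_itv.
by rewrite restrict_EFin -patch_refl.
Qed.

Lemma Rintegral_refl a b c (f : R -> R) : L1 a b f ->
  \int[leb]_(t in `[c - b, c - a]) f (c - t) = \int[leb]_(t in `[a, b]) f t.
Proof.
move=> iF.
have : leb.-integrable setT (EFin \o (f \_ `[a, b])).
  rewrite -restrict_EFin.
  by apply: (integrable_mkcond (mu := leb) _ _).1 => //; exact: measurable_itv.
move=> /(refl_integral c)[_ H].
by rewrite Rintegral_mkcond [RHS]Rintegral_mkcond -patch_refl /Rintegral H.
Qed.

Lemma abs_continuous_refl a b (f : R -> R) : abs_continuous a b f ->
  abs_continuous a b (fun t => f (a + b - t)).
Proof.
move=> fAC e e0; have [d d0 H] := fAC e e0; exists d => // k u v uv dis sd.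
apply: le_lt_trans (H k (fun i => a + b - v i) (fun i => a + b - u i) _ _ _).
- by apply: ler_sum => i _; rewrite distrC.
- by move=> i; have [? [? ?]] := uv i; split; [lra|split; lra].
- by move=> i j /dis[] ?; [right|left]; lra.
by apply: le_lt_trans sd; apply: ler_sum => i _; lra.
Qed.

Lemma ae_deriv_refl p q a b (X Y : R -> 'M[R]_(p, q)) : ae_deriv a b X Y ->
  ae_deriv a b (fun t => X (a + b - t)) (fun t => - Y (a + b - t)).
Proof.
move=> [XAC dX]; split=> [i j|]; first exact: abs_continuous_refl (XAC i j).
apply: filterS (ae_refl (a + b) dX) => t; rewrite in_itv_refl => H tab i j.
have dr : is_derive t 1 (fun u : R => a + b - u) (- 1).
  apply: (is_derive_eq (is_deriveB (is_derive_cst (a + b) t 1) (is_derive_id t 1))).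
  exact: sub0r.
have := @is_derive1_comp _ (fun u => X u i j) (fun u => a + b - u) t _ _ (H tab i j) dr.
by rewrite mxE mulrN1.
Qed.

Lemma L1mx_refl p q a b c (X : R -> 'M[R]_(p, q)) : L1mx a b X ->
  L1mx (c - b) (c - a) (fun t => X (c - t)).
Proof. by move=> iX i j; exact: integrable_refl (iX i j). Qed.

Lemma L1mx_refl_itv p q a b (X : R -> 'M[R]_(p, q)) : L1mx a b X ->
  L1mx a b (fun t => X (a + b - t)).
Proof. by move/(L1mx_refl (a + b)); rewrite addrK [a + b]addrC addrK addrC. Qed.

Lemma integral_mx_refl p q a b c (X : R -> 'M[R]_(p, q)) : L1mx a b X ->
  integral_mx (c - b) (c - a) (fun t => X (c - t)) = integral_mx a b X.
Proof.
by move=> iX; apply/matrixP => i j; rewrite !mxE; exact: Rintegral_refl (iX i j).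
Qed.

Lemma integral_mx_refl_itv p q a b (X : R -> 'M[R]_(p, q)) : L1mx a b X ->
  integral_mx a b (fun t => X (a + b - t)) = integral_mx a b X.
Proof.
move/(integral_mx_refl (a + b)) => <-.
by rewrite addrK [a + b]addrC addrK.
Qed.

Lemma L2mx_refl_itv p q a b (X : R -> 'M[R]_(p, q)) : L2mx a b X ->
  L2mx a b (fun t => X (a + b - t)).
Proof.
move=> X2 i j; split.
  by have /= := L1mx_refl_itv (L2mx_L1mx X2) i j; exact: integrable_measurable.
have [_ iX] := X2 i j; have := integrable_refl (a + b) iX.
by rewrite addrK [a + b]addrC addrK.
Qed.

End TimeReversal.

(** * Coefficients and the costate kernel by duality *)

Section Coefficients.
Variable R : realType.
Local Notation leb := (@lebesgue_measure R).
Implicit Types (a b : R).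

Lemma coercive_unitmx p (A : 'M[R]_p) r : 0 < r -> psd (A - r%:M) -> A \in unitmx.
Proof.
move=> r0 [_ Apos]; apply: unitmx_ker0 => x Ax; apply: sqnorm_le0_eq0.
have := Apos x; rewrite mulmxBr mulmxBl -mulmxA Ax mulmx0 sub0r mul_mx_scalar.
by rewrite -scalemxAl mxE oppr_ge0 mxE pmulr_rle0.
Qed.

(** Let [y] be the [j]-th column of the inverse.  Coercivity at [y] reads
[r |y|^2 <= y_j], so [y_j <= r^-1] and then [y_i^2 <= r^-1 y_j <= r^-2]. *)
Lemma coercive_invmx_le p (A : 'M[R]_p) r i j : 0 < r -> psd (A - r%:M) ->
  `|invmx A i j| <= r^-1.
Proof.
move=> r0 Ar; have uA := coercive_unitmx r0 Ar; case: Ar => _ Apos.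
have [y [Ay yE]] : exists y : 'cV[R]_p,
    A *m y = delta_mx j 0 /\ forall k, y k 0 = invmx A k j.
  by exists (invmx A *m delta_mx j 0); split=> [|k]; rewrite ?mulKVmx// -colE mxE.
have sq k : y k 0 ^+ 2 <= (y^T *m y) 0 0.
  rewrite mxE (bigD1 k)//= mxE -expr2 lerDl sumr_ge0// => l _.
  by rewrite mxE -expr2 sqr_ge0.
have le_j : r * (y^T *m y) 0 0 <= y j 0.
  have := Apos y; rewrite mulmxBr mulmxBl mul_mx_scalar -scalemxAl -mulmxA Ay -colE.
  by rewrite -subr_ge0 !mxE.
rewrite -yE.
have rV : 0 < r^-1 by rewrite invr_gt0.
have rr : r * r^-1 = 1 by rewrite mulfV// gt_eqF.
have sqi := sq i; have sqj := sq j.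
have yj_ge0 : 0 <= y j 0.
  by apply: le_trans le_j; rewrite mulr_ge0 ?(ltW r0)// (le_trans _ sqj)// sqr_ge0.
have yj_le : y j 0 <= r^-1 by nra.
rewrite -(@ler_pXn2r _ 2)// ?nnegrE// ?(ltW rV)// real_normK ?num_real//.
have : r * y i 0 ^+ 2 <= r^-1 by nra.
by nra.
Qed.

(** [x^-1 = x (x^2)^-1], and real powers are measurable. *)
Lemma measurable_invf (D : set R) (f : R -> R) : measurable_fun D f ->
  measurable_fun D (fun t => (f t)^-1).
Proof.
move=> mf.
rewrite (_ : (fun t => _) = fun t => f t * (f t ^+ 2) `^ (-1)); last first.
  apply/funext => t; rewrite powR_inv1 ?sqr_ge0//.
  by have [->|f0] := eqVneq (f t) 0; [rewrite invr0 mul0r|field].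
apply: measurable_funM => //.
by apply: measurableT_comp (measurable_powR _) _; exact: measurable_funX.
Qed.

Lemma measurable_det p (D : set R) (A : R -> 'M[R]_p) :
  (forall i j, measurable_fun D (fun t => A t i j)) ->
  measurable_fun D (fun t => \det (A t)).
Proof.
move=> mA; apply: measurable_sum => s; apply: measurable_funM => //.
by apply: measurable_prod => i _.
Qed.

Lemma measurable_invmx p (D : set R) (A : R -> 'M[R]_p) i j : measurable D ->
  (forall i j, measurable_fun D (fun t => A t i j)) ->
  measurable_fun D (fun t => invmx (A t) i j).
Proof.
move=> mD mA; have mdet := measurable_det mA.
rewrite (_ : (fun t => _) = (fun t => if \det (A t) == 0 then A t i j
    else (\det (A t))^-1 * cofactor (A t) j i)); last first.
  apply/funext => t; have [d0|d0] := eqVneq.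
    by rewrite /invmx unitmxE unitfE d0 eqxx.
  by rewrite invmx_entryE// unitmxE unitfE.
apply: measurable_fun_if => //.
- exact: measurable_fun_eqr.
- by apply: measurable_funS (mA i j).
apply: (@measurable_funS _ _ _ _ D) => //.
apply: measurable_funM; first exact: measurable_invf.
apply: measurable_funM => //; apply: measurable_det => k l.
by under [X in measurable_fun _ X]funext do rewrite !mxE; exact: mA.
Qed.

(** The entries of R^-1 are measurable and bounded, and products of two entries of
H are integrable. *)
Lemma HRH_L1mx n m a b r (H : R -> 'M[R]_(m, n)) (Rm : R -> 'M[R]_m) :
  L2mx a b H -> L2mx a b Rm -> 0 < r ->
  {ae leb, forall t, t \in `[a, b] -> (Rm t)^T = Rm t /\ psd (Rm t - r%:M)} ->
  L1mx a b (HRH H Rm).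
Proof.
move=> H2 R2 r0 HR i j.
have : leb.-integrable `[a, b] (EFin \o (fun t =>
    \sum_l \sum_k H t k i * H t l j * invmx (Rm t) k l)).
  apply: integrable_sumf => l _; apply: integrable_sumf => k _.
  apply: (integrable_mul_bounded (M := r^-1)).
  - have [? ?] := H2 k i; have [? ?] := H2 l j; exact: integrable_mul_L2.
  - by apply: measurable_invmx => // u v; have [] := R2 u v.
  by apply: filterS HR => t HR /HR[_ Rr]; exact: coercive_invmx_le.
apply: eq_integrable => // t _ /=; congr EFin; rewrite /HRH mxE.
apply: eq_bigr => l _; rewrite mxE mulr_suml; apply: eq_bigr => k _.
by rewrite mxE mulrAC.
Qed.

Lemma HRH_sym n m (H : R -> 'M[R]_(m, n)) (Rm : R -> 'M[R]_m) t :
  (Rm t)^T = Rm t -> (HRH H Rm t)^T = HRH H Rm t.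
Proof. by move=> RT; rewrite /HRH !trmx_mul trmxK trmx_inv RT mulmxA. Qed.

Lemma GQG_sym n d (G : R -> 'M[R]_(n, d)) (Q : R -> 'M[R]_d) t :
  (Q t)^T = Q t -> (GQG G Q t)^T = GQG G Q t.
Proof. by move=> QT; rewrite /GQG !trmx_mul trmxK QT mulmxA. Qed.

End Coefficients.

Section Duality.
Variables (R : realType) (n : nat) (t0 T : R).
Variables (F S N : R -> 'M[R]_n) (Pi0 SigmaT : 'M[R]_n).
Local Notation leb := (@lebesgue_measure R).
Local Notation rho t := (t0 + T - t).

(** The defining property of Lambda for arbitrary [S] and [N]. *)
Definition costate_kernel (L : R -> R -> 'M[R]_n) : Prop :=
  forall s, s \in `[t0, T] -> forall lmu, L2mx t0 T lmu ->
  [/\ L1mx t0 T (fun t => L s t *m lmu t),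
      exists mu nu, hamiltonian_bvp t0 T F S N Pi0 SigmaT lmu (fun=> 0) mu nu &
      forall mu nu, hamiltonian_bvp t0 T F S N Pi0 SigmaT lmu (fun=> 0) mu nu ->
        nu s = integral_mx t0 T (fun t => L s t *m lmu t)].

Local Notation dual_bvp := (hamiltonian_bvp t0 T (fun t => (F (rho t))^T)
  (fun t => N (rho t)) (fun t => S (rho t)) SigmaT Pi0).
Local Notation dual_kernel := (state_kernel t0 T (fun t => (F (rho t))^T)
  (fun t => N (rho t)) (fun t => S (rho t)) SigmaT Pi0).

Let rhoK t : rho (rho t) = t. Proof. by ring. Qed.
Let rho_start : rho t0 = T. Proof. by ring. Qed.
Let rho_end : rho T = t0. Proof. by ring. Qed.

(** Reversing time changes the sign of both derivatives; the substitution
[(mu, nu) |-> (nu, - mu)] restores them and exchanges the two equations. *)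
Lemma hamiltonian_bvp_dual l mu nu :
  hamiltonian_bvp t0 T F S N Pi0 SigmaT l (fun=> 0) mu nu ->
  dual_bvp (fun=> 0) (fun t => l (rho t)) (fun t => nu (rho t)) (fun t => - mu (rho t)).
Proof.
move=> [mu_eq nu_eq mu_start nu_end]; split.
- apply: ae_deriv_eqr (ae_deriv_refl nu_eq); apply: nearW => t _.
  by rewrite opprK subr0 addr0 mulmxN opprK.
- apply: ae_deriv_eqr (ae_derivN (ae_deriv_refl mu_eq)); apply: nearW => t _.
  by rewrite trmxK opprK mulmxN !opprD !opprK.
- by rewrite rho_start mulmxN opprK.
- by rewrite rho_end mu_start opprK.
Qed.

(** The inverse substitution, [(mu, nu) |-> (- nu, mu)] in reversed time. *)
Lemma dual_hamiltonian_bvp l mu nu : dual_bvp (fun=> 0) l mu nu ->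
  hamiltonian_bvp t0 T F S N Pi0 SigmaT (fun t => l (rho t)) (fun=> 0)
    (fun t => - nu (rho t)) (fun t => mu (rho t)).
Proof.
move=> [mu_eq nu_eq mu_start nu_end]; split.
- apply: ae_deriv_eqr (ae_derivN (ae_deriv_refl nu_eq)); apply: nearW => t _.
  by rewrite !rhoK trmxK opprK mulmxN !opprD !opprK.
- apply: ae_deriv_eqr (ae_deriv_refl mu_eq); apply: nearW => t _.
  by rewrite !rhoK addr0 subr0 mulmxN.
- by rewrite rho_start nu_end.
- by rewrite rho_end mu_start mulmxN.
Qed.

(** Both directions translate solutions and integrals by time reversal, which is an
involution of the segment preserving Lebesgue measure. *)
Lemma costate_kernel_dual L :
  costate_kernel L <-> dual_kernel (fun s t => L (rho s) (rho t)).
Proof.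
split=> HL s sI l l_L2.
- have rsI : rho s \in `[t0, T] by rewrite in_itv_refl.
  have [iL [mu [nu sol]] EL] := HL _ rsI _ (L2mx_refl_itv l_L2).
  split.
  + by apply: L1mx_eq (L1mx_refl_itv iL) => t _; rewrite rhoK.
  + exists (fun t => nu (rho t)), (fun t => - mu (rho t)).
    have := hamiltonian_bvp_dual sol.
    by under [X in hamiltonian_bvp _ _ _ _ _ _ _ _ X]funext do rewrite rhoK.
  move=> mu' nu' /dual_hamiltonian_bvp /EL /=; rewrite rhoK => ->.
  rewrite -(integral_mx_refl_itv iL).
  by apply: integral_mx_eq => t _; rewrite rhoK.
have rsI : rho s \in `[t0, T] by rewrite in_itv_refl.
have [iL [mu [nu sol]] EL] := HL _ rsI _ (L2mx_refl_itv l_L2).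
split.
- by apply: L1mx_eq (L1mx_refl_itv iL) => t _; rewrite !rhoK.
- exists (fun t => - nu (rho t)), (fun t => mu (rho t)).
  have := dual_hamiltonian_bvp sol.
  by under [X in hamiltonian_bvp _ _ _ _ _ _ _ X]funext do rewrite rhoK.
move=> mu' nu' /hamiltonian_bvp_dual /EL /=.
rewrite -(integral_mx_refl_itv iL) rhoK => ->.
by apply: integral_mx_eq => t _; rewrite !rhoK.
Qed.

Variables (P : 'M[R]_n) (Pi : R -> 'M[R]_n) (Phi : R -> R -> 'M[R]_n).

Hypothesis t0T : t0 < T.
Hypotheses (F_L1 : L1mx t0 T F) (N_L1 : L1mx t0 T N).
Hypothesis S_sym : {ae leb, forall t, t \in `[t0, T] -> (S t)^T = S t}.
Hypothesis N_sym : {ae leb, forall t, t \in `[t0, T] -> (N t)^T = N t}.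
Hypotheses (P_psd : psd P) (PP : P *m P = SigmaT).
Hypothesis Pi_psd : forall t, t \in `[t0, T] -> psd (Pi t).
Hypothesis Pi_eq : ae_deriv t0 T Pi (fun t =>
  F t *m Pi t + Pi t *m (F t)^T - Pi t *m N t *m Pi t + S t).
Hypothesis Pi_start : Pi t0 = Pi0.
Hypothesis Phi_eq : transition_mx t0 T (fun t => F t - Pi t *m N t) Phi.

(** In the second argument, [Phi s] solves the adjoint equation
   [Phi s u' = - Phi s u (F - Pi N) u]; reversing time and transposing makes this the
   closed-loop equation of the dual problem. *)
Let dual_transition : transition_mx t0 T
  (fun t => (F (rho t))^T - N (rho t) *m Pi (rho t))
  (fun tau t => (Phi (rho t) (rho tau))^T).
Proof.
pose B t := F t - Pi t *m N t.
have B_L1 : L1mx t0 T B.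
  by apply: L1mxD => //; apply/L1mxN/L1mx_mull => //; case: Pi_eq.
have t0I : t0 \in `[t0, T] by rewrite in_itv/= lexx ltW.
have [Y_eq _] := Phi_eq t0I.
have Y_unit t : t \in `[t0, T] -> Phi t t0 \in unitmx.
  by move=> tI; have [] := transition_mx_factor (ltW t0T) B_L1 Phi_eq tI.
have factor s t : s \in `[t0, T] -> t \in `[t0, T] ->
    Phi s t = Phi s t0 *m invmx (Phi t t0).
  by move=> sI tI; have [_] := transition_mx_factor (ltW t0T) B_L1 Phi_eq tI; apply.
(* The cocycle factorization turns the second argument of [Phi] into an inverse,
   whose derivative is known. *)
have back s : s \in `[t0, T] ->
    ae_deriv t0 T (fun u => Phi s u) (fun u => - (Phi s u *m B u)).
  move=> sI.
  apply: (ae_deriv_eql (X := fun u => Phi s t0 *m invmx (Phi u t0))).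
    by move=> u uI; rewrite -factor.
  have := ae_derivM (ae_deriv_cst t0 T (Phi s t0)) (ae_deriv_invmx Y_unit Y_eq).
  apply: ae_deriv_eqr; apply: nearW => u uI.
  by rewrite mul0mx add0r mulmxN (factor s u)// /B !mulmxA mulmxK ?Y_unit.
move=> t tI; have rtI : rho t \in `[t0, T] by rewrite in_itv_refl.
split; last by have [_ ->] := Phi_eq rtI; rewrite trmx1.
apply: ae_deriv_eqr (ae_deriv_tr (ae_deriv_refl (back _ rtI))).
apply: filterS (ae_refl (t0 + T) N_sym) => u Nu uI.
rewrite opprK trmx_mul /B linearB/= trmx_mul Nu ?in_itv_refl//.
by have [-> _] := Pi_psd (t := rho u) (etrans (in_itv_refl _ _ _) uI).
Qed.

(** The dual problem has forward kernel [K0]; evaluated at reversed times, its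
formula becomes the one for Lambda. *)
Theorem costate_kernel_formula : is_the_kernel t0 T costate_kernel (fun s t =>
  (Phi T s)^T *m P *m invmx (1%:M + P *m Pi T *m P) *m P *m Phi T t +
  integral_mx (Num.max s t) T (fun tau => (Phi tau s)^T *m N tau *m Phi tau t)).
Proof.
have Pi_dual : ae_deriv t0 T (fun t => Pi (rho t)) (fun t =>
    - (Pi (rho t) *m (F (rho t))^T + ((F (rho t))^T)^T *m Pi (rho t)
       - Pi (rho t) *m N (rho t) *m Pi (rho t) + S (rho t))).
  apply: ae_deriv_eqr (ae_deriv_refl Pi_eq); apply: nearW => t _.
  by rewrite trmxK [F _ *m _ + _]addrC.
have N_dual : {ae leb, forall t, t \in `[t0, T] -> (N (rho t))^T = N (rho t)}.
  by apply: filterS (ae_refl (t0 + T) N_sym) => t; rewrite in_itv_refl.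
have Pi_psd_dual t : t \in `[t0, T] -> psd (Pi (rho t)).
  by move=> tI; apply: Pi_psd; rewrite in_itv_refl.
have Pi_end : Pi (rho T) = Pi0 by rewrite rho_end.
have := state_kernel_formula t0T (L1mx_tr (L1mx_refl_itv F_L1)) (L1mx_refl_itv N_L1)
  N_dual P_psd PP Pi_psd_dual Pi_dual Pi_end dual_transition.
set K0 := (X in is_the_kernel _ _ _ X); set L0 := (X in _ -> is_the_kernel _ _ _ X).
move=> [K0_kernel K0_uniq].
have K0E s t : s \in `[t0, T] -> t \in `[t0, T] -> K0 s t = L0 (rho s) (rho t).
  move=> sI tI; rewrite /K0 /L0 rho_start !trmxK; congr (_ + _).
  pose c := Num.min s t.
  (* Time reversal exchanges minimum and maximum. *)
  have maxE : Num.max (rho s) (rho t) = rho c.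
    by rewrite /c; case: leP => st; case: leP => // ts; lra.
  pose f tau := (Phi tau (rho s))^T *m N tau *m Phi tau (rho t).
  have rsI : rho s \in `[t0, T] by rewrite in_itv_refl.
  have rtI : rho t \in `[t0, T] by rewrite in_itv_refl.
  have f_L1 : L1mx t0 T f.
    have [[Ps_AC _] _] := Phi_eq rsI; have [[Pt_AC _] _] := Phi_eq rtI.
    apply: L1mx_mulr => //; apply: L1mx_mull => // i j.
    by under [X in abs_continuous _ _ X]funext do rewrite mxE; exact: Ps_AC.
  have cT : c <= T by rewrite ge_min; move: sI; rewrite in_itv/= => /andP[_ ->].
  have fc_L1 : L1mx (rho c) T f by apply: L1mx_sub f_L1 => //; lra.
  rewrite maxE -/c -(integral_mx_refl (t0 + T) fc_L1) rhoK addrK.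
  by apply: integral_mx_eq => tau _; rewrite trmxK.
split.
  apply/costate_kernel_dual => s sI l l_L2; have [iK sol EK] := K0_kernel s sI l l_L2.
  have KE t : t \in `[t0, T] -> K0 s t *m l t = L0 (rho s) (rho t) *m l t.
    by move=> tI; rewrite K0E.
  split; [exact: L1mx_eq KE iK|exact: sol|move=> mu nu /EK ->].
  exact: integral_mx_eq KE.
move=> L /costate_kernel_dual/K0_uniq HL s sI.
have rsI : rho s \in `[t0, T] by rewrite in_itv_refl.
have := ae_refl (t0 + T) (HL _ rsI); apply: filterS => t.
rewrite in_itv_refl !rhoK => H tI; rewrite H// K0E ?in_itv_refl// !rhoK//.
Qed.

End Duality.

(** * The two kernels *)

Theorem theorem2 (R : realType) (n m d : nat) (t0 T r : R)
  (F : R -> 'M[R]_n) (G : R -> 'M[R]_(n, d)) (H : R -> 'M[R]_(m, n))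
  (Q : R -> 'M[R]_d) (Rm : R -> 'M[R]_m)
  (Pi0 SigmaT Pi0h SigmaTh : 'M[R]_n) (Sigma Pi : R -> 'M[R]_n)
  (PhiSigma PhiPi : R -> R -> 'M[R]_n)
  (n_gt0 : (0 < n)%N) (m_gt0 : (0 < m)%N) (d_gt0 : (0 < d)%N)
  (t0_lt_T : t0 < T)
  (F_L1 : L1mx t0 T F) (G_L2 : L2mx t0 T G) (H_L2 : L2mx t0 T H)
  (Q_L1 : L1mx t0 T Q)
  (Q_psd : {ae @lebesgue_measure R, forall t, t \in `[t0, T] -> psd (Q t)})
  (Rm_L2 : L2mx t0 T Rm) (r_gt0 : 0 < r)
  (Rm_ge : {ae @lebesgue_measure R, forall t, t \in `[t0, T] ->
             (Rm t)^T = Rm t /\ psd (Rm t - r%:M)})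
  (GQG_L1 : L1mx t0 T (GQG G Q))
  (Pi0_psd : psd Pi0) (SigmaT_psd : psd SigmaT)
  (Pi0h_sqrt : psd_sqrt Pi0 Pi0h) (SigmaTh_sqrt : psd_sqrt SigmaT SigmaTh)
  (Sigma_psd : forall t, t \in `[t0, T] -> psd (Sigma t))
  (Sigma_eq : ae_deriv t0 T Sigma (fun t =>
     - (Sigma t *m F t + (F t)^T *m Sigma t
        - Sigma t *m GQG G Q t *m Sigma t + HRH H Rm t)))
  (Sigma_end : Sigma T = SigmaT)
  (Pi_psd : forall t, t \in `[t0, T] -> psd (Pi t))
  (Pi_eq : ae_deriv t0 T Pi (fun t =>
     F t *m Pi t + Pi t *m (F t)^T
     - Pi t *m HRH H Rm t *m Pi t + GQG G Q t))
  (Pi_start : Pi t0 = Pi0)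
  (PhiSigma_eq :
     transition_mx t0 T (fun t => F t - GQG G Q t *m Sigma t) PhiSigma)
  (PhiPi_eq :
     transition_mx t0 T (fun t => F t - Pi t *m HRH H Rm t) PhiPi) :
  is_the_kernel t0 T (mu_kernel t0 T F G H Q Rm Pi0 SigmaT)
    (fun s t =>
       PhiSigma s t0 *m Pi0h *m invmx (1%:M + Pi0h *m Sigma t0 *m Pi0h)
         *m Pi0h *m (PhiSigma t t0)^T
       + integral_mx t0 (Num.min s t) (fun tau =>
           PhiSigma s tau *m GQG G Q tau *m (PhiSigma t tau)^T)) /\
  is_the_kernel t0 T (nu_kernel t0 T F G H Q Rm Pi0 SigmaT)
    (fun s t =>
       (PhiPi T s)^T *m SigmaTh *m invmx (1%:M + SigmaTh *m Pi T *m SigmaTh)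
         *m SigmaTh *m PhiPi T t
       + integral_mx (Num.max s t) T (fun tau =>
           (PhiPi tau s)^T *m HRH H Rm tau *m PhiPi tau t)).
Proof.
have S_sym : {ae @lebesgue_measure R, forall t, t \in `[t0, T] ->
    (GQG G Q t)^T = GQG G Q t}.
  by apply: filterS Q_psd => t Q_psd /Q_psd[QT _]; exact: GQG_sym.
have N_sym : {ae @lebesgue_measure R, forall t, t \in `[t0, T] ->
    (HRH H Rm t)^T = HRH H Rm t}.
  by apply: filterS Rm_ge => t Rm_ge /Rm_ge[RT _]; exact: HRH_sym.
have N_L1 : L1mx t0 T (HRH H Rm) := HRH_L1mx H_L2 Rm_L2 r_gt0 Rm_ge.
have [Ph_psd PhPh] := Pi0h_sqrt; have [Sh_psd ShSh] := SigmaTh_sqrt.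
split.
  exact: (state_kernel_formula t0_lt_T F_L1 GQG_L1 S_sym Ph_psd PhPh
    Sigma_psd Sigma_eq Sigma_end PhiSigma_eq).
exact: (costate_kernel_formula t0_lt_T F_L1 N_L1 N_sym Sh_psd ShSh
  Pi_psd Pi_eq Pi_start PhiPi_eq).
Qed.
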